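(* Let $(\Sigma,\mathcal{B},\mu)$ be a measure space, $H=L^2(\Sigma)$, $V$ a real locally convex topological vector space and $j:V\to L^2(\Sigma)$ a linear, weak-to-weak continuous operator. Assume that $\varphi:V\to\mathbb{R}\cup\{+\infty\}$ is convex, proper, lower semicontinuous and $j$-elliptic, that $j(D(\varphi))$ is dense in $L^2(\Sigma)$, and let $S$ be the semigroup on $L^2(\Sigma)$ generated by $(\varphi,j)$. Then the following assertions are equivalent: (1) The semigroup $S$ is $L^\infty$-contractive on $L^2(\Sigma)$. (2) For every $u_1,u_2\in H$ and for every $\alpha>0$ one has $$\varphi^H\Big(\big(u_1\vee\tfrac{u_1+u_2-\alpha}{2}\big)\wedge\tfrac{u_1+u_2+\alpha}{2}\Big)+\varphi^H\Big(\big(u_2\wedge\tfrac{u_1+u_2+\alpha}{2}\big)\vee\tfrac{u_1+u_2-\alpha}{2}\Big)\le\varphi^H(u_1)+\varphi^H(u_2).$$ (3) For every $\hat u_1,\hat u_2\in D(\varphi)$ with $u_1=j(\hat u_1)$ and $u_2=j(\hat u_2)$, and for every $\alpha>0$, there are $\hat v_1,\hat v_2\in D(\varphi)$ such that $$\big(u_1\vee\tfrac{u_1+u_2-\alpha}{2}\big)\wedge\tfrac{u_1+u_2+\alpha}{2}=j(\hat v_1),\qquad \big(u_2\wedge\tfrac{u_1+u_2+\alpha}{2}\big)\vee\tfrac{u_1+u_2-\alpha}{2}=j(\hat v_2),$$ and $\varphi(\hat v_1)+\varphi(\hat v_2)\le\varphi(\hat u_1)+\varphi(\hat u_2)$.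
   Context: The effective domain of $\varphi$ is $D(\varphi)=\{\varphi<+\infty\}$; $\varphi$ is proper if $D(\varphi)\neq\emptyset$, lower semicontinuous if all sublevels $\{\varphi\le c\}$, $c\in\mathbb{R}$, are closed, and coercive if all sublevels are relatively weakly compact. The functional $\varphi$ is $j$-elliptic if there exists $\omega\ge 0$ such that $\hat u\mapsto\varphi(\hat u)+\frac{\omega}{2}\|j(\hat u)\|_H^2$ is convex and coercive. The $j$-subgradient of $\varphi$ is $$\partial_j\varphi=\Big\{(u,f)\in H\times H \;:\; \exists\,\hat u\in D(\varphi)\text{ with } j(\hat u)=u \text{ and, for every }\hat v\in V,\ \liminf_{t\searrow 0}\frac{\varphi(\hat u+t\hat v)-\varphi(\hat u)}{t}\ge\langle f,j(\hat v)\rangle_H\Big\}.$$ $\partial\psi$ denotes the classical subgradient of a functional $\psi$ on $H$ (the case $V=H$, $j=I$). $\varphi^H:H\to\mathbb{R}\cup\{+\infty\}$ denotes a convex, proper, lower semicontinuous functional with $\partial_j\varphi\subseteq\partial\varphi^H$; it exists, is unique up to an additive constant, and modulo that constant $\varphi^H(u)=\inf\{\varphi(\hat u): j(\hat u)=u\}$. The semigroup generated by $(\varphi,j)$: for every $u_0\in\overline{j(D(\varphi))}$ (here all of $L^2(\Sigma)$) the problem $\dot u+\partial_j\varphi(u)\ni 0$ a.e. on $(0,\infty)$, $u(0)=u_0$, has a unique solution $u\in C(\mathbb{R}_+;H)\cap W^{1,\infty}_{loc}((0,\infty);H)$, and $S(t)u_0:=u(t)$. $S$ is $L^\infty$-contractive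 if $\|S(t)u_1-S(t)u_2\|_{L^\infty}\le\|u_1-u_2\|_{L^\infty}$ for all $u_1,u_2\in L^2(\Sigma)$, $t\ge0$, where $\|u\|_{L^\infty}:=+\infty$ if $u\in L^2(\Sigma)\setminus L^\infty(\Sigma)$. The operations $\wedge,\vee$ are pointwise a.e. minimum and maximum of real-valued functions. *)

(* Defs.v *)
From HB Require Import structures.
From mathcomp Require Import all_boot all_order all_algebra.
From mathcomp Require Import all_classical all_reals all_analysis.
From mathcomp Require Import measurable_realfun ess_sup_inf.
From mathcomp Require Import lra.
Set Implicit Arguments.
Unset Strict Implicit.
Unset Printing Implicit Defensive.
Import Order.TTheory GRing.Theory Num.Theory.
Import numFieldNormedType.Exports.
Local Open Scope classical_set_scope.
Local Open Scope ring_scope.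

(* The library's [LspaceType mu p1] (classes of measurable functions with
   finite ['N[mu]_p]) comes without any algebraic or metric structure.  We
   equip it with the pointwise a.e. operations and the [L^p]-norm, so that it is
   a [normedModType R].                                                       *)
Section Lspace_structure.
Context d (T : measurableType d) (R : realType).
Variables (mu : {measure set T -> \bar R}) (p : \bar R) (p1 : (1 <= p)%E).

Local Notation Lf := (LfunType mu p1).
Local Notation Lp := (LspaceType mu p1).

Lemma Lnorm_ae_eq (f g : T -> R) :
  measurable_fun setT f -> measurable_fun setT g ->
  f = g %[ae mu] -> 'N[mu]_p[EFin \o f]%E = 'N[mu]_p[EFin \o g]%E.
Proof.
move=> mf mg fg; rewrite unlock /Lnorm.
case: p p1 => [r _|_|//].
- have mnorm (h : T -> R) : measurable_fun setT h ->
      measurable_fun setT (poweR^~ r \o (abse \o (EFin \o h))).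
    move=> mh.
    have mh' : measurable_fun setT (abse \o (EFin \o h)).
      by apply: measurableT_comp => //; exact/measurable_EFinP.
    exact: (measurableT_comp (measurable_poweR _) mh').
  congr (_ `^ _)%E; apply: ae_eq_integral => //; [exact: mnorm|exact: mnorm|].
  by apply: filterS fg => x /(_ I) /= -> _.
- case: ifPn => // mu0; apply: eq_ess_sup.
  by apply: filterS fg => x /(_ I) /= ->.
Qed.

Local Open Scope quotient_scope.

(* [measurableTypeR R] and [R] have the same measurable sets, but are not the
   same [measurableType]; [LspaceType] uses the former, [LfunType] the latter. *)
Lemma Lfun_measurableR (f : Lf) :
  @measurable_fun _ _ T (measurableTypeR R) setT f.
Proof. exact: (@measurable_funPT _ _ _ _ f). Qed.

Lemma mfun_measurableR (f : {mfun T >-> measurableTypeR R}) :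
  @measurable_fun _ _ T R setT f.
Proof. exact: (@measurable_funPT _ _ _ _ f). Qed.

Definition Lmfun (f : Lf) : {mfun T >-> measurableTypeR R} :=
  @mfun_Sub _ _ T (measurableTypeR R) f (mem_set (Lfun_measurableR f)).

Lemma repr_pi_ae (f : {mfun T >-> measurableTypeR R}) :
  repr (\pi_({mfun_ mu, T >-> measurableTypeR R}) f) = f %[ae mu].
Proof. by apply/asboolP; rewrite -[X in is_true X]/(ae_eq_op mu _ _) -eqmodE reprK. Qed.

Lemma finite_norm_pi (f : Lf) :
  finite_norm mu p
    (\pi_({mfun_ mu, T >-> measurableTypeR R}) (Lmfun f)
      : {mfun_ mu, T >-> measurableTypeR R}).
Proof.
rewrite /finite_norm (@Lnorm_ae_eq _ f) //; first exact: Lfunction_finite.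
- exact: mfun_measurableR.
- exact: repr_pi_ae.
Qed.

Definition Lclass (f : Lf) : Lp :=
  @LebesgueSpace.Pack _ _ _ mu p p1 _
    (LebesgueSpace.Class (@isFinLebesgue.Axioms_ _ _ _ _ _ _ _ (finite_norm_pi f))).

Lemma LclassE (f : Lf) : Lclass f = f %[ae mu].
Proof. exact: repr_pi_ae. Qed.

Lemma Lspace_eqP (f g : Lp) : f = g <-> f = g %[ae mu].
Proof.
split=> [->|fg]; first exact/aeW.
have : LebesgueSpace.sort f = LebesgueSpace.sort g.
  rewrite -[LHS]reprK -[RHS]reprK.
  by apply/eqmodP; exact/asboolP.
case: f fg => f [[nf]]; case: g => g [[ng]] /= _ fg.
by rewrite {}fg in nf *; rewrite (Prop_irrelevance nf ng).
Qed.

Lemma Lspace_Lfun (f : Lp) : (f : T -> R) \in Lfun mu p.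
Proof.
rewrite inE; apply/andP; split.
  by apply/mem_set; exact: (@measurable_funPT _ _ _ _ (repr (LebesgueSpace.sort f))).
by apply/mem_set; case: f => f [[]].
Qed.

Definition Lrepr (f : Lp) : Lf := Lfun_Sub p1 (Lspace_Lfun f).

Let Ladd f g := Lclass (Lrepr f + Lrepr g).
Let Lopp f := Lclass (- Lrepr f).
Let Lscale (a : R) f := Lclass (a *: Lrepr f).
Let Lzero := Lclass 0.
Let Lpnorm (f : Lp) : R := fine ('N[mu]_p[EFin \o f])%E.

Let LaddE f g : \forall x \ae mu, Ladd f g x = f x + g x.
Proof. by have := LclassE (Lrepr f + Lrepr g); apply: filterS => x /(_ I) ->. Qed.

Let LoppE f : \forall x \ae mu, Lopp f x = - f x.
Proof. by have := LclassE (- Lrepr f); apply: filterS => x /(_ I) ->. Qed.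

Let LscaleE a f : \forall x \ae mu, Lscale a f x = a * f x.
Proof. by have := LclassE (a *: Lrepr f); apply: filterS => x /(_ I) ->. Qed.

Let LzeroE : \forall x \ae mu, Lzero x = 0.
Proof. by have := LclassE 0; apply: filterS => x /(_ I) ->. Qed.

Let Lspace_ext (f g : Lp) : (\forall x \ae mu, f x = g x) -> f = g.
Proof. by move=> fg; apply/Lspace_eqP; apply: filterS fg => x ->. Qed.

HB.instance Definition _ := gen_eqMixin Lp.
HB.instance Definition _ := gen_choiceMixin Lp.

Let LaddA : associative Ladd.
Proof.
move=> f g h; apply: Lspace_ext.
near=> x.
have -> : Ladd f (Ladd g h) x = f x + Ladd g h x by near: x; exact: LaddE.
have -> : Ladd g h x = g x + h x by near: x; exact: LaddE.
have -> : Ladd (Ladd f g) h x = Ladd f g x + h x by near: x; exact: LaddE.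
have -> : Ladd f g x = f x + g x by near: x; exact: LaddE.
by rewrite addrA.
Unshelve. all: by end_near. Qed.

Let LaddC : commutative Ladd.
Proof.
move=> f g; apply: Lspace_ext; near=> x.
have -> : Ladd f g x = f x + g x by near: x; exact: LaddE.
have -> : Ladd g f x = g x + f x by near: x; exact: LaddE.
by rewrite addrC.
Unshelve. all: by end_near. Qed.

Let Ladd0 : left_id Lzero Ladd.
Proof.
move=> f; apply: Lspace_ext; near=> x.
have -> : Ladd Lzero f x = Lzero x + f x by near: x; exact: LaddE.
have -> : Lzero x = 0 by near: x; exact: LzeroE.
by rewrite add0r.
Unshelve. all: by end_near. Qed.

Let LaddN : left_inverse Lzero Lopp Ladd.
Proof.
move=> f; apply: Lspace_ext; near=> x.
have -> : Ladd (Lopp f) f x = Lopp f x + f x by near: x; exact: LaddE.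
have -> : Lopp f x = - f x by near: x; exact: LoppE.
have -> : Lzero x = 0 by near: x; exact: LzeroE.
by rewrite addNr.
Unshelve. all: by end_near. Qed.

HB.instance Definition _ := GRing.isZmodule.Build Lp LaddA LaddC Ladd0 LaddN.

Let LscaleA a b f : Lscale a (Lscale b f) = Lscale (a * b) f.
Proof.
apply: Lspace_ext; near=> x.
have -> : Lscale a (Lscale b f) x = a * Lscale b f x by near: x; exact: LscaleE.
have -> : Lscale b f x = b * f x by near: x; exact: LscaleE.
have -> : Lscale (a * b) f x = a * b * f x by near: x; exact: LscaleE.
by rewrite mulrA.
Unshelve. all: by end_near. Qed.

Let Lscale1 : left_id 1 Lscale.
Proof.
move=> f; apply: Lspace_ext; near=> x.
have -> : Lscale 1 f x = 1 * f x by near: x; exact: LscaleE.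
by rewrite mul1r.
Unshelve. all: by end_near. Qed.

Let LscaleDr : right_distributive Lscale +%R.
Proof.
move=> a f g; rewrite -[f + g]/(Ladd f g).
rewrite -[_ + _]/(Ladd (Lscale a f) (Lscale a g)).
apply: Lspace_ext; near=> x.
have -> : Lscale a (Ladd f g) x = a * Ladd f g x by near: x; exact: LscaleE.
have -> : Ladd f g x = f x + g x by near: x; exact: LaddE.
have -> : Ladd (Lscale a f) (Lscale a g) x = Lscale a f x + Lscale a g x.
  by near: x; exact: LaddE.
have -> : Lscale a f x = a * f x by near: x; exact: LscaleE.
have -> : Lscale a g x = a * g x by near: x; exact: LscaleE.
by rewrite mulrDr.
Unshelve. all: by end_near. Qed.

Let LscaleDl f : {morph Lscale^~ f : a b / a + b}.
Proof.
move=> a b /=; rewrite -[_ + _ in RHS]/(Ladd (Lscale a f) (Lscale b f)).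
apply: Lspace_ext; near=> x.
have -> : Lscale (a + b) f x = (a + b) * f x by near: x; exact: LscaleE.
have -> : Ladd (Lscale a f) (Lscale b f) x = Lscale a f x + Lscale b f x.
  by near: x; exact: LaddE.
have -> : Lscale a f x = a * f x by near: x; exact: LscaleE.
have -> : Lscale b f x = b * f x by near: x; exact: LscaleE.
by rewrite mulrDl.
Unshelve. all: by end_near. Qed.

HB.instance Definition _ := GRing.Zmodule_isLmodule.Build R Lp
  LscaleA Lscale1 LscaleDr LscaleDl.

Lemma LspaceDE (f g : Lp) : \forall x \ae mu, (f + g) x = f x + g x.
Proof. exact: LaddE. Qed.

Lemma LspaceNE (f : Lp) : \forall x \ae mu, (- f) x = - f x.
Proof. exact: LoppE. Qed.

Lemma LspaceZE a (f : Lp) : \forall x \ae mu, (a *: f) x = a * f x.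
Proof. exact: LscaleE. Qed.

Lemma Lspace0E : \forall x \ae mu, (0 : Lp) x = 0.
Proof. exact: LzeroE. Qed.

Let Lspace_measurable (f : Lp) : measurable_fun setT (f : T -> R).
Proof. exact: (@measurable_funPT _ _ _ _ (Lrepr f)). Qed.

Let LpnormE (f : Lp) (g : Lf) : f = g %[ae mu] ->
  Lpnorm f = fine ('N[mu]_p[EFin \o g])%E.
Proof. by move=> fg; congr fine; apply: Lnorm_ae_eq. Qed.

Let Lpnorm_triangle (f g : Lp) : Lpnorm (f + g) <= Lpnorm f + Lpnorm g.
Proof.
rewrite (@LpnormE (f + g) (Lrepr f + Lrepr g)); last exact: LclassE.
exact: ler_LnormD.
Qed.

Let LpnormZ a (f : Lp) : Lpnorm (a *: f) = `|a| * Lpnorm f.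
Proof.
rewrite (@LpnormE (a *: f) (a *: Lrepr f)); last exact: LclassE.
by rewrite [X in fine X]LnormZ -(finite_norm_fine (Lrepr f)).
Qed.

Let Lpnorm0_eq0 (f : Lp) : Lpnorm f = 0 -> f = 0.
Proof.
move=> /(@fine_Lnormr_eq0 _ _ _ _ _ _ (Lrepr f)) f0; apply: Lspace_ext.
near=> x.
have -> : (0 : Lp) x = 0 by near: x; exact: Lspace0E.
by near: x; apply: filterS f0 => x /(_ I).
Unshelve. all: by end_near. Qed.

HB.instance Definition _ := @Lmodule_isNormed.Build R Lp
  Lpnorm Lpnorm_triangle LpnormZ Lpnorm0_eq0.

Lemma Lspace_normE (f : Lp) : `|f|%:E = 'N[mu]_p[EFin \o f]%E.
Proof. exact: (finite_norm_fine (Lrepr f)). Qed.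

End Lspace_structure.

Section truncations.
Context d (T : measurableType d) (R : realType).

(* [(u1 \/ (u1 + u2 - a) / 2) /\ (u1 + u2 + a) / 2] and
   [(u2 /\ (u1 + u2 + a) / 2) \/ (u1 + u2 - a) / 2], pointwise. *)
Definition trunc1 (a : R) (u1 u2 : T -> R) : T -> R := fun x =>
  Num.min (Num.max (u1 x) ((u1 x + u2 x - a) / 2)) ((u1 x + u2 x + a) / 2).

Definition trunc2 (a : R) (u1 u2 : T -> R) : T -> R := fun x =>
  Num.max (Num.min (u2 x) ((u1 x + u2 x + a) / 2)) ((u1 x + u2 x - a) / 2).

Lemma trunc1_bound (a : R) (u1 u2 : T -> R) x : 0 < a ->
  `|trunc1 a u1 u2 x| <= `|u1 x| + `|u2 x|.
Proof.
move=> a0; rewrite /trunc1.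
have := ler_norm (u1 x); have := ler_norm (- u1 x); rewrite normrN.
have := ler_norm (u2 x); have := ler_norm (- u2 x); rewrite normrN.
move: (u1 x) (u2 x) => r s; rewrite ler_norml /Num.min /Num.max.
by case: (ltP r) => ?; case: ltP => ? *; apply/andP; split; lra.
Qed.

Lemma trunc2_bound (a : R) (u1 u2 : T -> R) x : 0 < a ->
  `|trunc2 a u1 u2 x| <= `|u1 x| + `|u2 x|.
Proof.
move=> a0; rewrite /trunc2.
have := ler_norm (u1 x); have := ler_norm (- u1 x); rewrite normrN.
have := ler_norm (u2 x); have := ler_norm (- u2 x); rewrite normrN.
move: (u1 x) (u2 x) => r s; rewrite ler_norml /Num.min /Num.max.
by case: (ltP s) => ?; case: ltP => ? *; apply/andP; split; lra.
Qed.

Variables (mu : {measure set T -> \bar R}) (p : \bar R) (p1 : (1 <= p)%E).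

Lemma le_Lnorm (f g : T -> R) :
  measurable_fun setT f -> measurable_fun setT g ->
  (forall x, `|f x| <= `|g x|) ->
  ('N[mu]_p[EFin \o f] <= 'N[mu]_p[EFin \o g])%E.
Proof.
move=> mf mg fg; rewrite unlock /Lnorm.
case: p p1 => [r r1|_|//].
- have r0 : 0 <= r by rewrite (le_trans ler01)// -lee_fin.
  have mnorm (h : T -> R) : measurable_fun setT h ->
      measurable_fun setT (poweR^~ r \o (abse \o (EFin \o h))).
    move=> mh.
    have mh' : measurable_fun setT (abse \o (EFin \o h)).
      by apply: measurableT_comp => //; exact/measurable_EFinP.
    exact: (measurableT_comp (measurable_poweR _) mh').
  apply: gt0_ler_poweR; rewrite ?invr_ge0// ?in_itv/= ?leey ?andbT.
  + by apply: integral_ge0 => x _; rewrite lee_fin powR_ge0.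
  + by apply: integral_ge0 => x _; rewrite lee_fin powR_ge0.
  apply: ge0_le_integral; first exact: measurableT.
  + by move=> x _; rewrite lee_fin powR_ge0.
  + exact: (mnorm f).
  + exact: (mnorm g).
  + by move=> x _; rewrite lee_fin ge0_ler_powR// nnegrE.
- case: ifPn => // mu0; apply: le_ess_sup.
  by apply/aeW => x /=; rewrite lee_fin.
Qed.

Let dominated_Lfun (f g h : T -> R) : f \in Lfun mu p -> g \in Lfun mu p ->
  measurable_fun setT h -> (forall x, `|h x| <= `|f x| + `|g x|) ->
  h \in Lfun mu p.
Proof.
have nL (k : T -> R) : k \in Lfun mu p -> Num.norm \o k \in Lfun mu p.
  move=> /andP[/set_mem mk /set_mem fk]; apply/andP; split; apply/mem_set.
    exact: measurableT_comp.
  rewrite /= /finite_norm (_ : 'N[mu]_p[_] = 'N[mu]_p[EFin \o k])%E//.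
  apply/eqP; rewrite eq_le !le_Lnorm//; first exact: measurableT_comp.
  - by move=> x /=; rewrite normr_id.
  - exact: measurableT_comp.
  - by move=> x /=; rewrite normr_id.
move=> fL gL mh hfg.
have : (Num.norm \o f : T -> R) + (Num.norm \o g) \in Lfun mu p.
  by case: (Lfun_addr_closed mu p1) => _; apply; exact: nL.
move=> /andP[/set_mem mfg /set_mem nfg]; apply/andP; split; apply/mem_set => //.
apply: le_lt_trans nfg; apply: le_Lnorm => // x.
by rewrite (le_trans (hfg x))// ler_norm.
Qed.

Let Lspace_measurable (f : LspaceType mu p1) : measurable_fun setT (f : T -> R).
Proof. exact: (@measurable_funPT _ _ _ _ (Lrepr f)). Qed.

Lemma trunc1_Lfun (a : R) (u1 u2 : LspaceType mu p1) : 0 < a ->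
  trunc1 a u1 u2 \in Lfun mu p.
Proof.
move=> a0; apply: (dominated_Lfun (Lspace_Lfun u1) (Lspace_Lfun u2)).
  apply: measurable_minr; first apply: measurable_maxr => //.
  - apply: measurable_funM => //; apply: measurable_funB => //.
    exact: measurable_funD.
  - apply: measurable_funM => //; apply: measurable_funD => //.
    exact: measurable_funD.
by move=> x; exact: trunc1_bound.
Qed.

Lemma trunc2_Lfun (a : R) (u1 u2 : LspaceType mu p1) : 0 < a ->
  trunc2 a u1 u2 \in Lfun mu p.
Proof.
move=> a0; apply: (dominated_Lfun (Lspace_Lfun u1) (Lspace_Lfun u2)).
  apply: measurable_maxr; first apply: measurable_minr => //.
  - apply: measurable_funM => //; apply: measurable_funD => //.
    exact: measurable_funD.
  - apply: measurable_funM => //; apply: measurable_funB => //.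
    exact: measurable_funD.
by move=> x; exact: trunc2_bound.
Qed.

(* When [mu] is infinite, [(u1 + u2 - a) / 2] need not be in [L^p]; the
   truncations are, provided [0 < a]. *)
Definition Ltrunc1 (a : R) (a0 : 0 < a) (u1 u2 : LspaceType mu p1) :
  LspaceType mu p1 := Lclass (Lfun_Sub p1 (trunc1_Lfun u1 u2 a0)).

Definition Ltrunc2 (a : R) (a0 : 0 < a) (u1 u2 : LspaceType mu p1) :
  LspaceType mu p1 := Lclass (Lfun_Sub p1 (trunc2_Lfun u1 u2 a0)).

End truncations.

Section weak_topology.
Context (R : realType).

Definition topological_dual (V : tvsType R) : Type :=
  {f : {linear V -> R^o} | continuous f}.

Definition weak (V : tvsType R) : topologicalType :=
  sup_topology (fun f : topological_dual V =>
    Topological.on (initial_topology (sval f : V -> R^o))).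

Definition weakly_continuous (V W : tvsType R) (j : V -> W) :=
  continuous (j : weak V -> weak W).

Definition relatively_weakly_compact (V : tvsType R) (A : set V) :=
  compact (closure (A : set (weak V))).

End weak_topology.

(* Functionals with values in [R `|` {+oo}] are represented as maps
   [phi : V -> \bar R] subject to the condition [gtNy_functional phi]. *)
Section functionals.
Context (R : realType).
Local Open Scope ereal_scope.

Definition gtNy_functional (V : Type) (phi : V -> \bar R) := forall v, -oo < phi v.

Definition effective_domain (V : Type) (phi : V -> \bar R) : set V :=
  [set v | phi v < +oo].

Definition proper_functional (V : Type) (phi : V -> \bar R) :=
  effective_domain phi !=set0.

Definition convex_functional (V : lmodType R) (phi : V -> \bar R) :=
  forall (u v : V) (t : R), (0 <= t <= 1)%R ->
    phi (t *: u + (1 - t) *: v)%R <= t%:E * phi u + (1 - t)%:E * phi v.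

Definition lsc_functional (V : topologicalType) (phi : V -> \bar R) :=
  forall c : R, closed [set v | phi v <= c%:E].

Definition coercive_functional (V : tvsType R) (phi : V -> \bar R) :=
  forall c : R, relatively_weakly_compact [set v | phi v <= c%:E].

Definition elliptic (V : tvsType R) (H : normedModType R) (j : V -> H)
    (phi : V -> \bar R) :=
  exists2 w : R, (0 <= w)%R &
    let phiw := fun u => phi u + (w / 2 * `|j u| ^+ 2)%:E in
    convex_functional phiw /\ coercive_functional phiw.

End functionals.

Section L2.
Context d (T : measurableType d) (R : realType).
Variable mu : {measure set T -> \bar R}.
Local Notation H := (LspaceType2 mu).

Definition L2dot (u v : H) : R := \int[mu]_x (u x * v x).

Definition subgradient (V : lmodType R) (j : V -> H) (phi : V -> \bar R) :
    set (H * H) :=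
  [set uf | exists2 u : V, effective_domain phi u & j u = uf.1 /\
    forall v : V, ((L2dot uf.2 (j v))%:E <=
      limf_einf (fun t : R => (phi (u + t *: v)%R - phi u) * t^-1%:E)
        (0 : R)^'+)%E].

(* The classical subgradient is the case [V = H], [j = id]. *)
Definition is_phiH (V : lmodType R) (j : V -> H) (phi : V -> \bar R)
    (phiH : H -> \bar R) :=
  [/\ gtNy_functional phiH, convex_functional phiH, proper_functional phiH,
      lsc_functional phiH & subgradient j phi `<=` subgradient id phiH].

Local Notation leb := (@lebesgue_measure R).

(* Strong (Bochner) measurability on ]0, +oo[. *)
Definition strongly_measurable (f : R -> H) :=
  exists s : (R -> H)^nat,
    (forall n, finite_set (range (s n)) /\
               forall v, measurable (s n @^-1` [set v])) /\
    (\forall t \ae leb, 0 < t -> s ^~ t @ \oo --> f t).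

(* [L^oo_loc(]0, +oo[; H)] *)
Definition Loo_loc (f : R -> H) :=
  strongly_measurable f /\
  forall a b : R, 0 < a -> exists M : R,
    \forall t \ae leb, t \in `[a, b] -> `|f t| <= M.

Definition test_function (theta : R -> R) :=
  [/\ forall t, derivable theta t 1, continuous (derive1 theta) &
      exists2 ab : R * R, 0 < ab.1 &
        forall t, t \notin `[ab.1, ab.2] -> theta t = 0].

(* [u] has weak derivative [g] on ]0, +oo[: the identity
   [\int theta' u = - \int theta g] of [H]-valued integrals, for all
   theta in [C^1_c(]0, +oo[)], is tested against every [h : H]. *)
Definition weak_derivative (u g : R -> H) :=
  forall theta : R -> R, test_function theta -> forall h : H,
    \int[leb]_(t in `]0, +oo[) (derive1 theta t * L2dot (u t) h) =
    - \int[leb]_(t in `]0, +oo[) (theta t * L2dot (g t) h).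

(* [u] is a solution in [C(R_+; H)], with [u] in [W^{1,oo}_loc(]0, +oo[; H)], of
   [u' + \partial_j phi (u) \ni 0] a.e. on ]0, +oo[, [u 0 = u0]. *)
Definition solution (V : lmodType R) (j : V -> H) (phi : V -> \bar R)
    (u0 : H) (u : R -> H) :=
  [/\ {within `[0, +oo[, continuous u}, u 0 = u0 &
      exists g : R -> H,
        [/\ Loo_loc u, Loo_loc g, weak_derivative u g &
            \forall t \ae leb, 0 < t -> subgradient j phi (u t, - g t)]].

Definition generated_semigroup (V : lmodType R) (j : V -> H)
    (phi : V -> \bar R) (S : R -> H -> H) :=
  forall u0, closure (j @` effective_domain phi) u0 ->
    solution j phi u0 (S ^~ u0).

(* [+oo] when [u] is not essentially bounded. *)
Definition Loo_norm (u : H) : \bar R := 'N[mu]_+oo[EFin \o u]%E.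

Definition Loo_contractive (S : R -> H -> H) :=
  forall (u1 u2 : H) (t : R), 0 <= t ->
    (Loo_norm (S t u1 - S t u2)%R <= Loo_norm (u1 - u2)%R)%E.

End L2.

(* Main.v *)
Require Import Defs.
From HB Require Import structures.
From mathcomp Require Import all_boot all_order all_algebra.
From mathcomp Require Import all_classical all_reals all_analysis.
From mathcomp Require Import measurable_realfun ess_sup_inf.
From mathcomp Require Import ring lra.
Set Implicit Arguments.
Unset Strict Implicit.
Unset Printing Implicit Defensive.
Import Order.TTheory GRing.Theory Num.Theory.
Import numFieldNormedType.Exports.
Local Open Scope classical_set_scope.
Local Open Scope ring_scope.

(** Put [e := Lexcess u1 u2], which is half the soft thresholding of [u1 - u2]
    at level [alpha].  The two truncations are [u1 - e] and [u2 + e]; together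
    they are the metric projection of [(u1, u2)], in [H * H], onto the closed
    convex set [C] of the pairs [(p, q)] with [`|p - q| <= alpha] a.e.
    [L^oo]-contractivity says that every [C] is invariant under
    [(p, q) |-> (S t p, S t q)], and the inequality (2) says that the projection
    onto [C] does not increase [Phi (p, q) := phiH p + phiH q].  The equivalence
    of (1) and (2) is thus an invariance criterion for the gradient flow of
    [Phi].

    (1) implies (2), [contractive_trunc].  Start the flow [U] at the projection
    [y] of a pair [x].  As [U] stays in [C], it never gets closer to [x] than
    [y].  But [-U'] is a subgradient, so [<U', U - x> <= Phi x - Phi U]; if
    [Phi y] exceeded [Phi x], lower semicontinuity would make the right-hand
    side at most a negative constant for small times, and [U] would approach
    [x]: [closest_point_le].

    (2) implies (1), [trunc_contractive].  Along two trajectories with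
    difference [w = u1 - u2], the derivative of the squared distance to [C] is
    a positive multiple of [<w', e>].  The two subgradient inequalities, tested
    with the truncations, bound [<w', e>] by the increment of [Phi] in (2),
    which is nonpositive ([supports_excess]); so the excess stays zero if it is
    zero at the start: [excess_zero].

    In neither direction is a curve in [H] differentiated.  Pairing the weak
    derivative with a fixed vector gives a scalar fundamental theorem of
    calculus ([weak_FTC], [curve_pair_le]), and freezing the vector at time [s]
    costs an error of order [(t - s) ^+ 2], which [quadratic_nonincreasing]
    absorbs.

    The equivalence of (2) and (3) rests on [phiH_image]: up to an additive
    constant, [phiH x] is the infimum of [phi] over the fibre of [j] at [x], and
    the infimum is attained.  For large [k] and every [x], ellipticity provides
    a minimiser [u] of [phi + k / 2 * `|j _ - x| ^+ 2], and it has the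
    subgradient [k *: (x - j u)].  The difference [phi u - phiH (j u)] is the
    same at all such points, since it varies at most quadratically with [x]
    ([gap_constant]); letting [k] tend to infinity moves [j u] to [x], and weak
    compactness with Mazur's theorem produces the preimage. *)

(** * A criterion for monotonicity *)

Section quadratic_nonincreasing.
Context (R : realType).

(** Cut [[a, b]] into [n] equal parts: the increments add up to at most
    [C * (b - a) ^+ 2 / n]. *)
Lemma quadratic_nonincreasing (f : R -> R) (a b C : R) : a <= b ->
  (forall s t, a <= s -> s <= t -> t <= b -> f t - f s <= C * (t - s) ^+ 2) ->
  f b <= f a.
Proof.
move=> ab H; rewrite leNgt; apply/negP => fab.
pose n := Num.truncn (`|C| * (b - a) ^+ 2 / (f b - f a)).
have n0 : 0 < n.+1%:R :> R by [].
pose h := (b - a) / n.+1%:R.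
have h0 : 0 <= h by rewrite divr_ge0// subr_ge0.
have nh : n.+1%:R * h = b - a by rewrite mulrC divfK// gt_eqF.
have step k : (k <= n.+1)%N -> f (a + k%:R * h) - f a <= k%:R * (C * h ^+ 2).
  elim: k => [|k IH] kn; first by rewrite !mul0r addr0 subrr.
  have := H (a + k%:R * h) (a + k.+1%:R * h).
  have -> : a + k.+1%:R * h - (a + k%:R * h) = h by rewrite -natr1; ring.
  have -> : a + k.+1%:R * h = a + k%:R * h + h by rewrite -natr1; ring.
  rewrite lerDl mulr_ge0// lerDl h0 => /(_ isT isT) H1.
  have {}H1 : f (a + k%:R * h + h) - f (a + k%:R * h) <= C * h ^+ 2.
    apply: H1; have : k.+1%:R * h <= n.+1%:R * h by rewrite ler_wpM2r// ler_nat.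
    by rewrite nh -natr1 mulrDl mul1r; lra.
  have := IH (ltnW kn); rewrite -natr1 mulrDl mul1r; lra.
have := step n.+1 (leqnn _); rewrite nh [a + _]addrC subrK.
apply/negP; rewrite -ltNge.
have -> : n.+1%:R * (C * h ^+ 2) = C * (b - a) ^+ 2 / n.+1%:R.
  by rewrite /h; field; rewrite addrC natr1 gt_eqF.
rewrite ltr_pdivrMr//.
apply: le_lt_trans (_ : `|C| * (b - a) ^+ 2 < _).
  by rewrite ler_wpM2r ?sqr_ge0// ler_norm.
rewrite -ltr_pdivrMl ?subr_gt0// mulrC.
by rewrite truncnS_gt// divr_ge0 ?subr_ge0 1?ltW// mulr_ge0 ?sqr_ge0.
Qed.

End quadratic_nonincreasing.

(** * The theorems of Hahn-Banach and Mazur *)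

Section Hahn_Banach.
Context (R : realType) (V : lmodType R).
Implicit Types (p q : V -> R).

Definition sublinear p :=
  [/\ p 0 = 0, forall x y, p (x + y) <= p x + p y
    & forall a x, 0 < a -> p (a *: x) <= a * p x].

Lemma sublinearZ p a x : sublinear p -> 0 <= a -> p (a *: x) = a * p x.
Proof.
move=> [p0 _ pZ]; rewrite le_eqVlt => /predU1P[<-|a0].
  by rewrite scale0r mul0r.
apply/eqP; rewrite eq_le pZ//= -[in leLHS](scale1r x) -(mulVf (lt0r_neq0 a0)).
rewrite -scalerA -ler_pdivlMl//; apply: pZ; by rewrite invr_gt0.
Qed.

Lemma sublinearN_ge p x : sublinear p -> - p (- x) <= p x.
Proof.
by move=> [p0 pD _]; rewrite lerNl -subr_ge0 opprK addrC -p0 -(subrr x) pD.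
Qed.

(** The largest sublinear functional below [p] whose value at [- v] is at most
    [- p v]. *)
Definition sublinear_shift p v : V -> R := fun y =>
  inf [set p (y + t *: v) - t * p v | t in [set t | 0 <= t]].

Section shift.
Variables (p : V -> R) (v : V).
Hypothesis pS : sublinear p.
Local Notation q := (sublinear_shift p v).

Let q_le y t : 0 <= t -> q y <= p (y + t *: v) - t * p v.
Proof.
move=> t0; apply: ge_inf; last by exists t.
exists (- p (- y)) => _ [s s0 <-]; rewrite -(sublinearZ v pS s0).
case: pS => _ pD _; rewrite lerBrDl lerBlDr.
by apply: le_trans (pD _ _); rewrite addrAC subrr add0r.
Qed.

Let q_ge y m : (forall t, 0 <= t -> m <= p (y + t *: v) - t * p v) -> m <= q y.
Proof.
move=> H; apply: lb_le_inf; first by exists (p (y + 0 *: v) - 0 * p v); exists 0 => /=.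
by move=> _ [t t0 <-]; exact: H.
Qed.

Lemma sublinear_shift_le y : q y <= p y.
Proof. by have := @q_le y 0 (lexx _); rewrite scale0r addr0 mul0r subr0. Qed.

Lemma sublinear_shiftN : q (- v) <= - p v.
Proof.
have := @q_le (- v) 1 ler01; rewrite scale1r addNr mul1r.
by case: pS => -> _ _; rewrite sub0r.
Qed.

Lemma sublinear_shiftP : sublinear q.
Proof.
have [p0 pD pZ] := pS; split.
- apply/eqP; rewrite eq_le; apply/andP; split.
    by rewrite -p0 sublinear_shift_le.
  by apply: q_ge => t t0; rewrite add0r sublinearZ// subrr.
- move=> x y; rewrite -lerBlDr; apply: q_ge => s s0.
  rewrite lerBlDr -lerBlDl; apply: q_ge => t t0; rewrite lerBlDl.
  apply: le_trans (q_le _ (addr_ge0 s0 t0)) _.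
  by rewrite scalerDl addrACA mulrDl opprD [leRHS]addrACA lerD2r pD.
- move=> a x a0; rewrite -ler_pdivrMl//; apply: q_ge => t t0.
  rewrite ler_pdivrMl//; apply: le_trans (q_le _ (mulr_ge0 (ltW a0) t0)) _.
  by rewrite -scalerA -scalerDr mulrBr mulrA lerD2r pZ.
Qed.

End shift.

Lemma sublinear_inf_chain p (A : set (V -> R)) : A !=set0 ->
  (forall q, A q -> sublinear q /\ forall y, q y <= p y) ->
  (forall q1 q2, A q1 -> A q2 ->
    (forall y, q1 y <= q2 y) \/ (forall y, q2 y <= q1 y)) ->
  let r y := inf [set q y | q in A] in
  sublinear r /\ forall q, A q -> forall y, r y <= q y.
Proof.
move=> [q0 Aq0] AS tot r.
have rle q y : A q -> r y <= q y.
  move=> Aq; apply: ge_inf; last by exists q.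
  exists (- p (- y)) => _ [s As <-]; have [sS sp] := AS _ As.
  by apply: le_trans (sublinearN_ge y sS); rewrite lerN2.
have rge y m : (forall q, A q -> m <= q y) -> m <= r y.
  move=> H; apply: lb_le_inf; first by exists (q0 y); exists q0.
  by move=> _ [q Aq <-]; exact: H.
split; last by move=> q Aq y; exact: rle.
split.
- apply/eqP; rewrite eq_le; apply/andP; split.
    by rewrite (le_trans (rle _ _ Aq0))//; have [[->]] := AS _ Aq0.
  by apply: (rge) => q /AS[[->]].
- move=> x y; rewrite -lerBlDr; apply: (rge) => q1 Aq1.
  rewrite lerBlDr -lerBlDl; apply: (rge) => q2 Aq2; rewrite lerBlDl.
  have [q [Aq qq1 qq2]] : exists q, [/\ A q, q x <= q1 x & q y <= q2 y].
    by have [H|H] := tot _ _ Aq1 Aq2; [exists q1|exists q2].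
  apply: le_trans (rle _ _ Aq) _; have [[_ qD _] _] := AS _ Aq.
  by rewrite (le_trans (qD _ _))// lerD.
- move=> a x a0; rewrite -ler_pdivrMl//; apply: (rge) => q Aq.
  rewrite ler_pdivrMl// (le_trans (rle _ _ Aq))//.
  by have [[_ _ qZ] _] := AS _ Aq; exact: qZ.
Qed.

(** Zorn's lemma for the reversed pointwise order; the lower bound of a chain is
    its pointwise infimum, which is finite because [- p (- y) <= p y] for a
    sublinear [p]. *)
Lemma minimal_sublinear p : sublinear p ->
  exists q, [/\ sublinear q, forall y, q y <= p y &
    forall r, sublinear r -> (forall y, r y <= q y) -> forall y, q y <= r y].
Proof.
move=> pS.
pose T := {q : V -> R | sublinear q /\ forall y, q y <= p y}.
pose Rl : rel T := fun q1 q2 : T => `[< forall y, sval q2 y <= sval q1 y >].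
have [| | | |qT qmin] := @Zorn T Rl.
- by move=> t; apply/asboolP.
- move=> t r s /asboolP qr /asboolP rs; apply/asboolP => y.
  exact: le_trans (rs y) (qr y).
- move=> [q qP] [r rP] /asboolP/= qr /asboolP/= rq; apply: eq_exist.
  by apply/funext => y; apply/eqP; rewrite eq_le qr rq.
- move=> A Atot; have [A0|/set0P[q0 Aq0]] := eqVneq A set0.
    by exists (exist _ p (conj pS (fun y => lexx _)) : T) => s; rewrite A0.
  pose B := [set sval q | q in A].
  have [||| rS rle] := @sublinear_inf_chain p B.
  + by exists (sval q0); exists q0.
  + by move=> _ [q Aq <-]; exact: (svalP q).
  + move=> _ _ [q1 A1 <-] [q2 A2 <-].
    by have [/asboolP|/asboolP] := Atot _ _ A1 A2; [right|left].
  have rp y : inf [set q y | q in B] <= p y.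
    apply: le_trans (rle (sval q0) _ y) _; first by exists q0.
    by have [_] := svalP q0; exact.
  exists (exist _ (fun y => inf [set q y | q in B]) (conj rS rp) : T) => s As; apply/asboolP => y /=.
  by apply: rle; exists s.
exists (sval qT); have [qS qp] := svalP qT; split => // r rS rq y.
have rp z : r z <= p z := le_trans (rq z) (qp z).
have /= := qmin (exist _ r (conj rS rp)).
by move=> <- //=; exact/asboolP.
Qed.

(** A minimal sublinear [q] is linear: its shift by any [v] lies below [q], hence
    equals [q], so that [q (- v) <= - q v].  Taking [q] below the shift of [p] by
    [x0] forces the value [p x0] at [x0]. *)
Theorem Hahn_Banach p (x0 : V) : sublinear p ->
  exists f : {linear V -> R^o}, (forall y, f y <= p y) /\ f x0 = p x0.
Proof.
move=> pS.
have [q [qS qp qmin]] := minimal_sublinear (sublinear_shiftP x0 pS).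
have qN v : q (- v) = - q v.
  apply/eqP; rewrite eq_le; apply/andP; split.
    apply: le_trans (sublinear_shiftN v qS).
    exact: qmin (sublinear_shiftP v qS) (sublinear_shift_le v qS) _.
  by have := sublinearN_ge (- v) qS; rewrite opprK.
have [q0 qD qZ] := qS.
have qDe x y : q (x + y) = q x + q y.
  apply/eqP; rewrite eq_le qD/=.
  by rewrite -[leRHS]opprK -qN lerNr !opprD -!qN qD.
have qlin : linear (q : V -> R^o).
  move=> a x y; rewrite qDe; congr (_ + _).
  have [a0|a0] := leP 0 a; first exact: sublinearZ.
  rewrite -[a in LHS]opprK scaleNr qN (sublinearZ _ qS) ?oppr_ge0 ?ltW//.
  by rewrite mulNr opprK.
pose f : {linear V -> R^o} := HB.pack q (GRing.isLinear.Build _ _ _ _ q qlin).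
exists f; split => [y|]; first exact: le_trans (qp y) (sublinear_shift_le x0 pS y).
apply/eqP; rewrite eq_le (le_trans (qp _) (sublinear_shift_le x0 pS _))/=.
by rewrite -lerN2 -[- f x0]qN (le_trans (qp _))// sublinear_shiftN.
Qed.

End Hahn_Banach.

Section gauge.
Context (R : realType) (V : lmodType R).

Definition convex_subset (A : set V) := forall x y (t : R),
  A x -> A y -> 0 <= t <= 1 -> A (t *: x + (1 - t) *: y).

(** The Minkowski functional of [D]. *)
Definition gauge (D : set V) (v : V) : R :=
  inf [set t | 0 < t /\ D (t^-1 *: v)].

Variable D : set V.
Hypotheses (Dc : convex_subset D) (D0 : D 0).
Hypothesis Dabs : forall v, exists2 t, 0 < t & D (t^-1 *: v).

Let gauge_lb v : has_lbound [set t | 0 < t /\ D (t^-1 *: v)].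
Proof. by exists 0 => t [/ltW]. Qed.

Lemma gauge_le v t : 0 < t -> D (t^-1 *: v) -> gauge D v <= t.
Proof. by move=> t0 Dt; apply: ge_inf. Qed.

Lemma gauge_ge v m : (forall t, 0 < t -> D (t^-1 *: v) -> m <= t) ->
  m <= gauge D v.
Proof.
move=> H; apply: lb_le_inf; first by have [t t0 Dt] := Dabs v; exists t.
by move=> t [t0 Dt]; exact: H.
Qed.

Lemma gauge_sublinear : sublinear (gauge D).
Proof.
split.
- apply/eqP; rewrite eq_le; apply/andP; split.
    apply/ler_addgt0Pl => e e0; rewrite addr0.
    by apply: gauge_le => //; rewrite scaler0.
  by apply: gauge_ge => t /ltW.
- move=> x y; rewrite -lerBlDr; apply: gauge_ge => s s0 Ds.
  rewrite lerBlDr -lerBlDl; apply: gauge_ge => t t0 Dt; rewrite lerBlDl.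
  have st0 : 0 < s + t by exact: addr_gt0.
  apply: gauge_le => //.
  have -> : (s + t)^-1 *: (x + y) =
      (s / (s + t)) *: (s^-1 *: x) + (1 - s / (s + t)) *: (t^-1 *: y).
    rewrite !scalerA scalerDr; congr (_ *: _ + _ *: _); field; lra.
  apply: Dc => //; apply/andP; split; first by rewrite divr_ge0 ?ltW.
  by rewrite ler_pdivrMr// mul1r lerDl ltW.
- move=> a x a0; rewrite -ler_pdivrMl//; apply: gauge_ge => t t0 Dt.
  rewrite ler_pdivrMl//; apply: gauge_le; first exact: mulr_gt0.
  by rewrite scalerA invfM mulrAC mulVf ?mul1r// gt_eqF.
Qed.

Lemma gauge_le1 v : D v -> gauge D v <= 1.
Proof. by move=> Dv; apply: gauge_le => //; rewrite invr1 scale1r. Qed.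

Lemma gauge_ge1 v : ~ D v -> 1 <= gauge D v.
Proof.
move=> nDv; apply: gauge_ge => t t0 Dt; rewrite leNgt; apply/negP => t1.
apply: nDv; have := Dc Dt D0 (t := t); rewrite scaler0 addr0 scalerA divff ?gt_eqF//.
by rewrite scale1r; apply; apply/andP; split; exact: ltW.
Qed.

End gauge.

Section Mazur.
Context (R : realType) (V : tvsType R).
Implicit Types (A U : set V).

Lemma linear_continuous_of_bound (f : {linear V -> R^o}) U :
  nbhs 0 U -> (forall u, U u -> `|f u| <= 1) -> continuous f.
Proof.
move=> U0 fU x; apply/cvgrPdist_lt => e e0.
have e20 : e / 2 != 0 by rewrite gt_eqF// divr_gt0.
have := nbhsT x (nbhs0Z e20 U0); apply: filterS => _ [_ [u Uu <-] <-].
rewrite linearD linearZ/= opprD addrA subrr add0r normrN normrM.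
rewrite gtr0_norm ?divr_gt0//; apply: le_lt_trans (_ : e / 2 < e).
  by rewrite ger_pMr ?divr_gt0// fU.
by rewrite ltr_pdivrMr// mulr_natr mulr2n ltrDl.
Qed.

Lemma locally_convex_nbhs0 U : nbhs 0 U ->
  exists W : set V, [/\ nbhs 0 W, W `<=` U & convex_subset W].
Proof.
move=> U0; have [B Bc [Bo /(_ 0 U U0)[W [BW W0] WU]]] := @locally_convex R V.
exists W; split => //; first by apply: open_nbhs_nbhs; split => //; exact: Bo.
move=> x y t Wx Wy /andP[t0 t1].
have := Bc W (mem_set BW) x y (Itv01 t0 t1) (mem_set Wx) (mem_set Wy).
by rewrite inE.
Qed.

Lemma nbhs0_absorbing U v : nbhs 0 U -> exists2 t : R, 0 < t & U (t *: v).
Proof.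
move=> U0; have /= := @scale_continuous R V (0, v) U.
rewrite scale0r => /(_ U0) [[B1 B2] /= [B10 B2v] BU].
have [e /= e0 eB] := B10; exists (e / 2); first exact: divr_gt0.
apply: (BU (e / 2, v)); split => /=; last exact: nbhs_singleton.
apply: eB => /=; rewrite sub0r normrN gtr0_norm ?divr_gt0//.
by rewrite ltr_pdivrMr// mulr_natr mulr2n ltrDl.
Qed.

(** Let [W] be a convex neighbourhood of [0] such that [x + W] misses [A], and
    [a0] in [A].  The convex set [D := A - a0 - W] absorbs every vector and does
    not contain [x - a0], so Hahn-Banach for its gauge gives a linear [f] with
    [f <= 1] on [D] and [1 <= f (x - a0)]; the part [- W] of [D] makes [f]
    continuous and the separation strict. *)
Lemma separation A x : convex_subset A -> closed A -> ~ A x ->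
  exists (f : topological_dual V) (c : R),
    (forall a, A a -> sval f a <= c) /\ c < sval f x.
Proof.
move=> Ac Acl nAx.
have [[a0 Aa0]|A0] := pselect (A !=set0); last first.
  have cst0 : continuous (\0 : {linear V -> R^o}) by exact: cst_continuous.
  exists (exist _ (\0 : {linear V -> R^o}) cst0), (- 1).
  by split => [a Aa|]; [case: A0; exists a|rewrite /= ltrN10].
have N0 : nbhs 0 [set v | ~ A (x + v)].
  have : nbhs x (~` A) by apply: open_nbhs_nbhs; split => //; exact: closed_openC.
  move=> /(nbhsB (- x)); rewrite addNr; apply: filterS => _ [w nAw <-].
  by rewrite /= addrA subrr add0r.
have [W [W0 WN Wc]] := locally_convex_nbhs0 N0.
pose D := [set d | exists a u, [/\ A a, W u & d = a - a0 - u]].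
have WD u : W u -> D (- u).
  by move=> Wu; exists a0, u; split => //; rewrite subrr add0r.
have Dc : convex_subset D.
  move=> _ _ t [a [u [Aa Wu ->]]] [b [w [Ab Ww ->]]] t01.
  exists (t *: a + (1 - t) *: b), (t *: u + (1 - t) *: w); split.
  - exact: Ac.
  - exact: Wc.
  - rewrite !scalerBr [LHS]addrACA [X in X + _ = _]addrACA -!opprD.
    rewrite -[X in _ - X - _ = _]scalerDl.
    by rewrite [t + _]addrC subrK scale1r.
have D0 : D 0 by rewrite -oppr0; apply: WD; exact: nbhs_singleton.
have Dabs v : exists2 t, 0 < t & D (t^-1 *: v).
  have [t t0 Wt] := nbhs0_absorbing (- v) W0.
  exists t^-1; first by rewrite invr_gt0.
  by rewrite invrK -[_ *: _]opprK -scalerN; exact: WD.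
have nDx : ~ D (x - a0).
  move=> [a [u [Aa /WN/= nAu]]] /eqP; rewrite addrAC (inj_eq (addIr _)) => /eqP xau.
  by apply: nAu; rewrite xau subrK.
have [f [fle fx]] := Hahn_Banach (x - a0) (gauge_sublinear Dc D0 Dabs).
have fx1 : 1 <= f (x - a0) by rewrite fx; exact: gauge_ge1.
have fD v : D v -> f v <= 1.
  by move=> Dv; apply: le_trans (fle v) _; exact: gauge_le1.
have fc : continuous f.
  apply: (@linear_continuous_of_bound _ (W `&` -%R @` W)).
    by apply: filterI => //; exact: nbhs0N.
  move=> u [Wu [w Ww wu]]; rewrite ler_norml; apply/andP; split.
    by rewrite lerNl -[leLHS](raddfN f); apply/fD/WD.
  by rewrite -wu; exact/fD/WD.
(* A multiple [- (e *: z)] in [W] turns [f <= 1] on [D] into [f <= 1 - e + f a0] on [A]. *)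
have [z zE] : exists z, z = x - a0 by exists (x - a0).
rewrite -zE in fx1; have [e e0 We] := nbhs0_absorbing (- z) W0.
exists (exist _ f fc), (1 - e + f a0); split => [a Aa|] /=; last first.
  by have := fx1; rewrite zE raddfB/=; lra.
have /fD : D (a - a0 - e *: - z) by exists a, (e *: - z).
rewrite !raddfB/= linearZ/= raddfN -[_ *: _]/(e * - f z).
have : e <= e * f z by rewrite ler_peMr// ltW.
set y := e * f z; rewrite mulrN -/y; lra.
Qed.

Lemma weak_continuous (f : topological_dual V) :
  continuous (sval f : weak V -> R^o).
Proof.
move=> x; have /cvg_sup -/(_ f) : nbhs (x : weak V) --> (x : weak V) by [].
move=> H; apply: cvg_trans (@initial_continuous _ _ (sval f : V -> R^o) x).
exact: cvg_app.
Qed.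

(** Mazur's theorem. *)
Theorem closed_convex_weakly_closed A : convex_subset A -> closed A ->
  closed (A : set (weak V)).
Proof.
move=> Ac Acl x Ax; apply: contrapT => nAx.
have [f [c [fA fx]]] := separation Ac Acl nAx.
have : nbhs (x : weak V) [set y | c < sval f y].
  apply: (@weak_continuous f x [set y : R | c < y]).
  by apply: open_nbhs_nbhs; split; [exact: open_gt|].
by move=> /Ax [y [Ay /=]]; rewrite ltNge fA.
Qed.

End Mazur.

(** * The inner product of L2 *)

Section L2_inner_product.
Context d (T : measurableType d) (R : realType) (mu : {measure set T -> \bar R}).
Local Notation H := (LspaceType2 mu).
Implicit Types (u v w h : H) (a : R).

Lemma L2_measurable u : measurable_fun setT (u : T -> R).
Proof. exact: (@measurable_funPT _ _ _ _ (Lrepr u)). Qed.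

Lemma L2dot_integrable u v : mu.-integrable setT (EFin \o (u \* v)).
Proof.
by apply/Lfun1_integrable; apply: Lfun2_mul_Lfun1; exact: Lspace_Lfun.
Qed.

Lemma ae_eq_L2 u v : (\forall x \ae mu, u x = v x) -> u = v.
Proof. by move=> uv; apply/Lspace_eqP; apply: filterS uv => x ->. Qed.

Lemma ae_eq_Rintegral (f g : T -> R) : measurable_fun setT f ->
  measurable_fun setT g -> (\forall x \ae mu, f x = g x) ->
  \int[mu]_x f x = \int[mu]_x g x.
Proof.
move=> mf mg fg; congr fine; apply: ae_eq_integral => //.
- exact/measurable_EFinP.
- exact/measurable_EFinP.
- by apply: filterS fg => x /= ->.
Qed.

Let mM u v : measurable_fun setT (u \* v).
Proof. by apply: measurable_funM; exact: L2_measurable. Qed.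

Lemma L2dotC u v : L2dot u v = L2dot v u.
Proof. by apply: eq_Rintegral => x _; rewrite mulrC. Qed.

Lemma L2dotDl u v w : L2dot (u + v) w = L2dot u w + L2dot v w.
Proof.
rewrite /L2dot -RintegralD//; [|exact: L2dot_integrable|exact: L2dot_integrable].
apply: ae_eq_Rintegral => //; first exact: mM.
  by apply: measurable_funD; exact: mM.
by apply: filterS (LspaceDE u v) => x ->; rewrite mulrDl.
Qed.

Lemma L2dotZl a u v : L2dot (a *: u) v = a * L2dot u v.
Proof.
rewrite /L2dot -RintegralZl//; last exact: L2dot_integrable.
apply: ae_eq_Rintegral => //; first exact: mM.
  by apply: measurable_funM => //; exact: mM.
by apply: filterS (LspaceZE a u) => x ->; rewrite mulrA.
Qed.

Lemma L2dot0l v : L2dot 0 v = 0.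
Proof. by rewrite -(scale0r v) L2dotZl mul0r. Qed.

Lemma L2dotNl u v : L2dot (- u) v = - L2dot u v.
Proof. by rewrite -scaleN1r L2dotZl mulN1r. Qed.

Lemma L2dotBl u v w : L2dot (u - v) w = L2dot u w - L2dot v w.
Proof. by rewrite L2dotDl L2dotNl. Qed.

Lemma L2dotDr u v w : L2dot w (u + v) = L2dot w u + L2dot w v.
Proof. by rewrite !(L2dotC w) L2dotDl. Qed.

Lemma L2dotZr a u v : L2dot v (a *: u) = a * L2dot v u.
Proof. by rewrite !(L2dotC v) L2dotZl. Qed.

Lemma L2dot0r v : L2dot v 0 = 0.
Proof. by rewrite L2dotC L2dot0l. Qed.

Lemma L2dotNr u v : L2dot v (- u) = - L2dot v u.
Proof. by rewrite !(L2dotC v) L2dotNl. Qed.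

Definition L2dotE := (L2dotDl, L2dotDr, L2dotNl, L2dotNr, L2dotZl, L2dotZr).

Lemma L2dotuu u : L2dot u u = `|u| ^+ 2.
Proof.
apply: EFin_inj; rewrite EFin_expe -/(_ ^+ _)%E Lspace_normE.
rewrite /L2dot /Rintegral fineK; last first.
  exact: (integrable_fin_num measurableT (L2dot_integrable u u)).
have N0 : 'N[mu]_2[EFin \o u]%E \is a fin_num by rewrite -(Lspace_normE u).
rewrite -(fineK N0) -EFin_expe -powR_mulrn ?fine_ge0 ?Lnorm_ge0//.
rewrite -poweR_EFin fineK// powR_Lnorm//.
apply: eq_integral => x _; congr EFin.
by rewrite powR_mulrn// real_normK ?num_real// expr2.
Qed.

Lemma L2dot_ge0 u : 0 <= L2dot u u. Proof. by rewrite L2dotuu sqr_ge0. Qed.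

Lemma sqr_normD u v : `|u + v| ^+ 2 = `|u| ^+ 2 + 2 * L2dot u v + `|v| ^+ 2.
Proof. by rewrite -!L2dotuu !L2dotE (L2dotC v u); ring. Qed.

Lemma sqr_normB u v : `|u - v| ^+ 2 = `|u| ^+ 2 - 2 * L2dot u v + `|v| ^+ 2.
Proof. by rewrite -!L2dotuu !L2dotE (L2dotC v u); ring. Qed.

(** Cauchy-Schwarz, from the square of [`|v| *: u - `|u| *: v]. *)
Lemma L2dot_le u v : L2dot u v <= `|u| * `|v|.
Proof.
have [u0|u0] := eqVneq `|u| 0.
  by move: u0 => /eqP; rewrite normr_eq0 => /eqP ->; rewrite L2dot0l normr0 mul0r.
have [v0|v0] := eqVneq `|v| 0.
  by move: v0 => /eqP; rewrite normr_eq0 => /eqP ->; rewrite L2dot0r normr0 mulr0.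
have uv0 : 0 < `|u| * `|v| by rewrite mulr_gt0 ?lt0r ?u0 ?v0/= .
rewrite -(ler_pM2l uv0); have := L2dot_ge0 (`|v| *: u - `|u| *: v).
by rewrite !L2dotE !L2dotuu (L2dotC v u); lra.
Qed.

Lemma L2dot_norm u v : `|L2dot u v| <= `|u| * `|v|.
Proof.
by rewrite ler_norml lerNl -L2dotNl -[in leRHS](normrN u) !L2dot_le.
Qed.

Lemma L2dotr_continuous h : continuous (fun u => L2dot u h : R^o).
Proof.
move=> u; apply/(@cvgrPdist_lt _ _ _ _ (nbhs_filter u)) => e e0.
have d0 : 0 < e / (1 + `|h|) by rewrite divr_gt0// ltr_pwDl.
have := nbhsx_ballx u _ d0; apply: filterS => v; rewrite -ball_normE/= => uv.
rewrite -L2dotBl; apply: le_lt_trans (L2dot_norm _ _) _.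
apply: le_lt_trans (_ : `|u - v| * (1 + `|h|) < e).
  by rewrite ler_wpM2l// lerDr.
by rewrite -ltr_pdivlMr ?ltr_pwDl.
Qed.

Lemma le_L2dot u v u' v' : (\forall x \ae mu, u x * v x <= u' x * v' x) ->
  L2dot u v <= L2dot u' v'.
Proof.
move=> le; rewrite -subr_ge0 /L2dot.
rewrite -RintegralB//; [|exact: L2dot_integrable|exact: L2dot_integrable].
rewrite (@ae_eq_Rintegral _ (fun x => `|u' x * v' x - u x * v x|)).
- by apply: Rintegral_ge0.
- by apply: measurable_funB; exact: mM.
- by apply: measurableT_comp => //; apply: measurable_funB; exact: mM.
- by apply: filterS le => x le; rewrite ger0_norm// subr_ge0.
Qed.

End L2_inner_product.

(** * Subgradients of convex functionals *)

Section supporting_functionals.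
Context d (T : measurableType d) (R : realType) (mu : {measure set T -> \bar R}).
Local Notation H := (LspaceType2 mu).

(** The first-order condition at a minimum: divide by [t] and let it tend to
    [0]. *)
Lemma linear_term_ge0 (A B : R) :
  (forall t, 0 < t <= 1 -> 0 <= t * A + t ^+ 2 * B) -> 0 <= A.
Proof.
move=> AB; rewrite leNgt; apply/negP => A0.
pose t := Num.min 1 (- A / (1 + `|B|)).
have B0 : 0 < 1 + `|B| by rewrite ltr_pwDl.
have t0 : 0 < t by rewrite lt_min ltr01 divr_gt0// oppr_gt0.
have := AB t; rewrite t0 ge_min lexx => /(_ isT).
rewrite expr2 -mulrA -mulrDr pmulr_rge0//; apply/negP; rewrite -ltNge.
rewrite -[A]opprK addrC subr_lt0.
have : t * (1 + `|B|) <= - A by rewrite -ler_pdivlMr// ge_min lexx orbT.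
apply: lt_le_trans; rewrite ltr_pM2l//.
by apply: le_lt_trans (ler_norm _) _; rewrite ltrDr.
Qed.

Lemma adde_lty_split (p q : \bar R) : (-oo < p)%E -> (-oo < q)%E ->
  (p + q < +oo)%E -> (p < +oo)%E /\ (q < +oo)%E.
Proof. by case: p q => [p||] [q||]//; rewrite ?ltry. Qed.

Section functional.
Context (V : lmodType R) (j : V -> H) (phi : V -> \bar R).
Hypotheses (phiNy : gtNy_functional phi) (phi_convex : convex_functional phi).

Lemma gtNy_fineK v : (phi v < +oo)%E -> phi v = (fine (phi v))%:E.
Proof. by move=> vy; rewrite fineK// fin_numElt vy phiNy. Qed.

(** The subgradient inequality in global form.  For a convex functional it is
    equivalent to the condition on the lower limit of the difference quotients
    in [subgradient]; this is the content of [subgradient_supports] and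
    [supports_subgradient]. *)
Definition supports (f : H) (u : V) := effective_domain phi u /\
  forall v, (phi u + (L2dot f (j v))%:E <= phi (u + v))%E.

Lemma supports_le f u v : supports f u -> (phi v < +oo)%E ->
  fine (phi u) + L2dot f (j (v - u)) <= fine (phi v).
Proof.
move=> [uy sup] vy; have := sup (v - u); rewrite [(u + _)%R]addrC subrK.
by rewrite (gtNy_fineK uy) (gtNy_fineK vy).
Qed.

Lemma convex_segment u v (t : R) : 0 < t <= 1 ->
  (phi u < +oo)%E -> (phi (u + v) < +oo)%E ->
  (phi (u + t *: v) <=
    ((1 - t) * fine (phi u) + t * fine (phi (u + v)))%:E)%E.
Proof.
move=> /andP[t0 t1] uy vy.
have -> : u + t *: v = t *: (u + v) + (1 - t) *: u.
  by rewrite scalerDr addrAC -scalerDl addrC [t + _]addrC subrK scale1r addrC.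
apply: le_trans (phi_convex _ _ _) _; first by rewrite (ltW t0).
by rewrite {1}(gtNy_fineK uy) {1}(gtNy_fineK vy) -!EFinM -EFinD lee_fin addrC.
Qed.

(** By convexity no difference quotient with [0 < t <= 1] exceeds the one at
    [t = 1]. *)
Lemma subgradient_supports u f : subgradient j phi (u, f) ->
  exists2 uh, j uh = u & supports f uh.
Proof.
move=> [uh uhy [/= juh Hf]]; exists uh => //; split => // v.
have [vy|] := ltP (phi (uh + v)) +oo%E; last by rewrite leye_eq => /eqP ->; rewrite leey.
rewrite (gtNy_fineK uhy) (gtNy_fineK vy) -EFinD lee_fin -lerBrDl -lee_fin.
apply: le_trans (Hf v) _; rewrite limf_einfE; apply: ge_ereal_sup => _ [A A0 <-].
have [t [At /andP[t0 t1]]] : exists t, A t /\ 0 < t <= 1.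
  have B0 : \forall t \near (0 : R)^'+, 0 < t <= 1.
    near=> t; apply/andP; split => //; near: t; exact: nbhs_right_le.
  by have [t [? ?]] := filter_ex (filterI A0 B0); exists t.
apply: ge_ereal_inf; exists ((phi (uh + t *: v) - phi uh) * t^-1%:E)%E.
  by exists t.
have seg := convex_segment (introT andP (conj t0 t1)) uhy vy.
have ty : (phi (uh + t *: v) < +oo)%E := le_lt_trans seg (ltry _).
move: seg; rewrite (gtNy_fineK ty) (gtNy_fineK uhy) lee_fin => seg.
rewrite -EFinB -EFinM lee_fin ler_pdivrMr//=.
move: seg => /=; set a := fine _; set b := fine _; set c := fine _; lra.
Unshelve. all: by end_near. Qed.

End functional.

Lemma supports_subgradient (V : lmodType R) (j : {linear V -> H})
    (phi : V -> \bar R) f uh :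
  gtNy_functional phi -> supports j phi f uh -> subgradient j phi (j uh, f).
Proof.
move=> phiNy [uhy sup]; exists uh => //; split => //= v.
rewrite limf_einfE; apply: le_trans (_ : ereal_inf _ <= _)%E; last first.
  by apply: ereal_sup_ubound; exists [set t | 0 < t]; first exact: nbhs_right_gt.
apply: le_ereal_inf_tmp => _ [t t0 <-].
have := sup (t *: v); rewrite linearZ L2dotZr (gtNy_fineK phiNy uhy).
have [ty|] := ltP (phi (uh + t *: v)) +oo%E.
  rewrite (gtNy_fineK phiNy ty) -EFinD -EFinB -EFinM !lee_fin => le.
  by rewrite ler_pdivlMr// lerBrDl mulrC.
rewrite leye_eq => /eqP -> _; rewrite addye// gt0_mulye ?leey// lte_fin.
by rewrite invr_gt0.
Qed.

End supporting_functionals.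

(** * Minimisers of the penalised functional *)

Section penalized_functional.
Context d (T : measurableType d) (R : realType) (mu : {measure set T -> \bar R}).
Local Notation H := (LspaceType2 mu).
Context (V : tvsType R) (j : {linear V -> H}) (phi : V -> \bar R).
Hypotheses (jweak : weakly_continuous j) (phiNy : gtNy_functional phi)
  (phi_convex : convex_functional phi) (phi_lsc : lsc_functional phi).

Lemma L2dotr_linear (h : H) : linear (fun u : H => L2dot u h : R^o).
Proof. by move=> a u v; rewrite L2dotDl L2dotZl. Qed.

Lemma weak_continuous_dot (h : H) :
  continuous ((fun v => L2dot (j v) h) : weak V -> R^o).
Proof.
pose f : {linear H -> R^o} := HB.pack (fun u : H => L2dot u h : R^o)
  (GRing.isLinear.Build _ _ _ _ _ (@L2dotr_linear h)).
pose F : topological_dual H := exist _ f (@L2dotr_continuous _ _ _ mu h).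
move=> v; apply: (@continuous_comp (weak V) (weak H) R^o (j : weak V -> weak H)
  (sval F : weak H -> R^o)); [exact: jweak|exact: weak_continuous].
Qed.

(** Sublevels are convex and closed, so Mazur's theorem applies. *)
Lemma sublevel_weakly_closed (c : R) :
  closed ([set v | (phi v <= c%:E)%E] : set (weak V)).
Proof.
apply: closed_convex_weakly_closed; last exact: phi_lsc.
move=> x y t /= xc yc /andP[t0 t1].
apply: le_trans (phi_convex _ _ _) _; first by rewrite t0.
apply: le_trans (leeD (lee_wpmul2l _ xc) (lee_wpmul2l _ yc)) _.
- by rewrite lee_fin.
- by rewrite lee_fin subr_ge0.
- by rewrite -!EFinM -EFinD lee_fin -mulrDl addrC subrK mul1r.
Qed.

(** A sum of lower semicontinuous functions is lower semicontinuous: a real [r]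
    strictly between [c - l v] and [phi v] separates [v] from the sublevel. *)
Lemma sublevel_add_weakly_closed (l : weak V -> R^o) (c : R) : continuous l ->
  closed ([set v | (phi v + (l v)%:E <= c%:E)%E] : set (weak V)).
Proof.
move=> lc v clv; rewrite /= leNgt; apply/negP => cv.
have [r /andP[r1 r2]] : exists r : R, (c - l v < r) && (r%:E < phi v)%E.
  move: cv (phiNy v); case: (phi v) => [a|_ _|//].
    rewrite -EFinD lte_fin -ltrBlDr => cv _.
    by exists ((c - l v + a) / 2); rewrite midf_lt// lte_fin midf_lt.
  by exists (c - l v + 1); rewrite ltrDl ltr01 ltry.
have n1 : nbhs (v : weak V) (~` [set v | (phi v <= r%:E)%E]).
  apply: open_nbhs_nbhs; split; first exact/closed_openC/sublevel_weakly_closed.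
  by rewrite /= leNgt r2.
have n2 : nbhs (v : weak V) [set w | c - r < l w].
  apply: (lc v [set y : R | c - r < y]); apply: open_nbhs_nbhs.
  by split; [exact: open_gt|rewrite /= ltrBlDr -ltrBlDl].
have [w [/= wc [/= /negP]]] := clv _ (filterI n1 n2).
rewrite -ltNge => rw cw; move: wc; rewrite leNgt => /negP; apply.
have : (r%:E + (c - r)%:E < phi w + (l w)%:E)%E by rewrite lteD// lte_fin.
by rewrite -EFinD addrC subrK.
Qed.

Definition penalized (k : R) (x : H) (v : V) : \bar R :=
  (phi v + (k / 2 * `|j v - x| ^+ 2)%:E)%E.

(** The penalty is only weakly lower semicontinuous.  At a point [v] of the
    closure it is replaced by its affine minorant [l] that is exact at [v], which
    is weakly continuous. *)
Lemma penalized_weakly_closed (k : R) (x : H) (c : R) : 0 <= k ->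
  closed ([set v | (penalized k x v <= c%:E)%E] : set (weak V)).
Proof.
move=> k0 v clv.
pose h := j v - x.
pose l w := k * (L2dot (j w) h - L2dot x h) - k / 2 * `|h| ^+ 2.
have lc : continuous (l : weak V -> R^o).
  have -> : l = (fun w => L2dot (j w) (k *: h)) +
      cst (- k * L2dot x h - k / 2 * `|h| ^+ 2).
    by apply/funext => w; rewrite /l fctE /= L2dotZr; ring.
  move=> w; exact: (cvgD (@weak_continuous_dot (k *: h) w) (cvg_cst (_ : R^o))).
have : [set v | (phi v + (l v)%:E <= c%:E)%E] v.
  apply: (sublevel_add_weakly_closed lc); apply: closureS clv => w /=.
  apply: le_trans; rewrite leeD2l// lee_fin /l.
  have := mulr_ge0 k0 (L2dot_ge0 (j w - x - h)).
  rewrite L2dotuu sqr_normB L2dotBl.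
  set a := L2dot _ _; set b := L2dot _ _; set n := `|h| ^+ 2; set m := `|_| ^+ 2.
  by lra.
by rewrite /= /penalized /l -L2dotBl -/h L2dotuu; congr (_ + _%:E <= _)%E; field.
Qed.

End penalized_functional.

Section resolvent.
Context d (T : measurableType d) (R : realType) (mu : {measure set T -> \bar R}).
Local Notation H := (LspaceType2 mu).
Context (V : tvsType R) (j : {linear V -> H}) (phi : V -> \bar R).
Hypotheses (jweak : weakly_continuous j) (phiNy : gtNy_functional phi)
  (phi_convex : convex_functional phi) (phi_lsc : lsc_functional phi).

(** Coercivity in the form in which it is used: a filter that contains a
    sublevel of the penalised functional clusters weakly. *)
Definition penalized_coercive (k : R) := forall (x : H) (c : R)
  (F : set_system (weak V)), ProperFilter F ->
  F [set v | (penalized j phi k x v <= c%:E)%E] -> cluster F !=set0.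

(** With [w] the ellipticity constant,
    [w / 2 * `|y| ^+ 2 <= w * `|y - x| ^+ 2 + w * `|x| ^+ 2], so for [2 * w <= k]
    the sublevels of the penalised functional lie in relatively compact ones. *)
Lemma elliptic_penalized_coercive : elliptic j phi ->
  exists2 k0 : R, 0 <= k0 & forall k, k0 <= k -> penalized_coercive k.
Proof.
move=> [w w0 [_ coe]]; exists (2 * w); first by rewrite mulr_ge0.
move=> k wk x c F PF Fc.
have sub : [set v | (penalized j phi k x v <= c%:E)%E] `<=`
    [set v | (phi v + (w / 2 * `|j v| ^+ 2)%:E <= (c + w * `|x| ^+ 2)%:E)%E].
  move=> v /= vc.
  have : (phi v + (k / 2 * `|j v - x| ^+ 2)%:E + (w * `|x| ^+ 2)%:E <=
          c%:E + (w * `|x| ^+ 2)%:E)%E by rewrite leeD2r.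
  apply: le_trans; rewrite -addeA leeD2l// -EFinD lee_fin.
  have := mulr_ge0 w0 (sqr_ge0 `|j v - x - x|).
  rewrite (sqr_normB (j v - x) x).
  have := sqr_normD (j v - x) x; rewrite subrK => ->.
  have : w * `|j v - x| ^+ 2 <= k / 2 * `|j v - x| ^+ 2.
    by rewrite ler_wpM2r ?sqr_ge0//; lra.
  set a := L2dot _ _; set b := `|j v - x| ^+ 2; set e := `|x| ^+ 2; lra.
have /(_ F PF) := coe (c + w * `|x| ^+ 2).
case.
  by apply: filterS Fc => v /sub ?; exact: subset_closure.
by move=> v [_ ?]; exists v.
Qed.

Lemma penalized_fin k x v : (phi v < +oo)%E ->
  penalized j phi k x v = (fine (phi v) + k / 2 * `|j v - x| ^+ 2)%:E.
Proof. by move=> vy; rewrite /penalized {1}(gtNy_fineK phiNy vy). Qed.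

(** The nonempty sublevels form a filter base; a cluster point belongs to all of
    them, since they are weakly closed. *)
Lemma penalized_min k x : 0 <= k -> proper_functional phi ->
  penalized_coercive k ->
  exists2 u, effective_domain phi u &
    forall v, (penalized j phi k x u <= penalized j phi k x v)%E.
Proof.
move=> k0 [v0 v0y] coe.
pose L (c : R) : set (weak V) := [set v | (penalized j phi k x v <= c%:E)%E].
pose C := [set c | L c !=set0].
pose c0 := fine (phi v0) + k / 2 * `|j v0 - x| ^+ 2.
have C0 : C c0 by exists v0; rewrite /L/= penalized_fin.
have FF : Filter (filter_from C L).
  apply: filter_from_filter; first by exists c0.
  move=> a b Ca Cb; exists (Num.min a b).
    by rewrite /Num.min; case: ifP.
  by move=> v /= vab; split; apply: le_trans vab _; rewrite lee_fin ge_min lexx ?orbT.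
have PF : ProperFilter (filter_from C L) by apply: filter_from_proper.
have [u Fu] := coe x c0 _ PF (ex_intro2 _ _ c0 C0 (@subset_refl _ _)).
have uL c : C c -> L c u.
  move=> Cc; apply: (penalized_weakly_closed jweak phiNy phi_convex phi_lsc k0).
  by move: Fu; rewrite clusterE; apply; exists c.
have ule v : (penalized j phi k x u <= penalized j phi k x v)%E.
  have [vy|] := ltP (phi v) +oo%E.
    by rewrite (penalized_fin _ _ vy); apply: uL; exists v; rewrite /L/= penalized_fin.
  by rewrite leye_eq => /eqP vy; rewrite {2}/penalized vy addye// leey.
exists u => //; have : (penalized j phi k x u < +oo)%E.
  by rewrite (le_lt_trans (ule v0))// penalized_fin// ltry.
rewrite /penalized /effective_domain/=.
by case: (phi u) => [r _||]//; exact: ltry.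
Qed.

(** The Euler-Lagrange inequality of the minimisation. *)
Lemma penalized_min_supports k x u : effective_domain phi u ->
  (forall v, (penalized j phi k x u <= penalized j phi k x v)%E) ->
  supports j phi (k *: (x - j u)) u.
Proof.
move=> uy umin; split => // v.
have [vy|] := ltP (phi (u + v)%R) +oo%E; last by rewrite leye_eq => /eqP ->; rewrite leey.
rewrite (gtNy_fineK phiNy uy) (gtNy_fineK phiNy vy) -EFinD lee_fin -subr_ge0.
apply: (@linear_term_ge0 _ _ (k / 2 * `|j v| ^+ 2)) => t t01.
have seg := convex_segment phiNy phi_convex t01 uy vy.
have ty : (phi (u + t *: v)%R < +oo)%E := le_lt_trans seg (ltry _).
move: seg (umin (u + t *: v)); rewrite {1}(gtNy_fineK phiNy ty) lee_fin.
rewrite !penalized_fin// lee_fin linearD linearZ/= addrAC (sqr_normD (j u - x)) normrZ exprMn.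
rewrite real_normK ?num_real// !L2dotE.
set a := fine _; set b := fine _; set c := fine _; set m := `|j v| ^+ 2.
set n := `|_| ^+ 2; set p := L2dot _ _; set q := L2dot _ _; lra.
Qed.

Lemma supports_exists k x : 0 <= k -> proper_functional phi ->
  penalized_coercive k -> exists u, supports j phi (k *: (x - j u)) u.
Proof.
move=> k0 prop coe; have [u uy umin] := penalized_min x k0 prop coe.
by exists u; exact: penalized_min_supports.
Qed.

End resolvent.

(** * The functional phiH as image of phi *)

Section gap.
Context d (T : measurableType d) (R : realType) (mu : {measure set T -> \bar R}).
Local Notation H := (LspaceType2 mu).
Context (V : tvsType R) (j : {linear V -> H}) (phi : V -> \bar R)
  (phiH : H -> \bar R).
Hypotheses (phiNy : gtNy_functional phi) (phiH_P : is_phiH j phi phiH).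

Let phiHNy : gtNy_functional phiH. Proof. by case: phiH_P. Qed.

Lemma supports_phiH f u : supports j phi f u -> supports id phiH f (j u).
Proof.
move=> sfu; case: phiH_P => _ cvx _ _ sub.
have /sub/(subgradient_supports phiHNy cvx) [_ -> //] : subgradient j phi (j u, f).
exact: supports_subgradient.
Qed.

(** Shown below to be the same at all points where [phi] has a subgradient. *)
Definition gap u : R := fine (phi u) - fine (phiH (j u)).

(** Compare the subgradient inequality of [phi] at [v], tested at [u], with that
    of [phiH] at [j u], tested at [j v].  With [w := j v - j u], what remains is
    [k * L2dot (z - y - w) w]. *)
Lemma gap_quadratic k y z u v : 0 <= k ->
  supports j phi (k *: (y - j u)) u -> supports j phi (k *: (z - j v)) v ->
  gap v - gap u <= k * `|z - y| ^+ 2.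
Proof.
move=> k0 su sv.
have [[uy _] [vy _]] := (su, sv).
have [suH svH] := (supports_phiH su, supports_phiH sv).
have [[uHy _] [vHy _]] := (suH, svH).
have := supports_le phiNy sv uy.
have := supports_le phiHNy suH vHy.
rewrite /gap /= !(raddfB j).
set w := j v - j u; set e := z - y.
have -> : j u - j v = - w by rewrite opprB.
have -> : z - j v = y - j u + (e - w).
  by rewrite /e /w opprB addrACA addKr [y + _]addrC subrK.
clearbody w e; rewrite !L2dotE L2dotuu.
have := mulr_ge0 k0 (sqr_ge0 `|e - w|); rewrite sqr_normB.
have := mulr_ge0 k0 (sqr_ge0 `|w|); have := mulr_ge0 k0 (sqr_ge0 `|e|).
set a := fine _; set b := fine _; set c := fine _; set a' := fine _.
set n := `|w| ^+ 2; set m := `|e| ^+ 2; set p := L2dot e w.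
set q := L2dot y w; set r := L2dot (j u) w; lra.
Qed.

(** A point [u] with subgradient [f] minimises the penalised functional centred
    at [j u + k^-1 *: f].  Along the segment between two such centres the gap of
    the minimisers has quadratically small increments. *)
Lemma gap_constant k f0 f1 u0 u1 : 0 < k ->
  (forall x, exists u, supports j phi (k *: (x - j u)) u) ->
  supports j phi f0 u0 -> supports j phi f1 u1 -> gap u1 <= gap u0.
Proof.
move=> k0 /choice[J JP] s0 s1.
pose x0 := j u0 + k^-1 *: f0; pose x1 := j u1 + k^-1 *: f1.
have fx f u : f = k *: (j u + k^-1 *: f - j u).
  by rewrite addrAC subrr add0r scalerA divff ?gt_eqF// scale1r.
rewrite (fx f0 u0) in s0; rewrite (fx f1 u1) in s1.
have endpoint x u v : supports j phi (k *: (x - j u)) u ->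
    supports j phi (k *: (x - j v)) v -> gap v <= gap u.
  move=> su sv; have := gap_quadratic (ltW k0) su sv.
  by rewrite subrr normr0 expr0n mulr0 subr_le0.
apply: le_trans (endpoint _ _ _ (JP x1) s1) _.
apply: le_trans _ (endpoint _ _ _ s0 (JP x0)).
clear s0 s1; clearbody x0 x1.
pose F (t : R) := gap (J (x0 + t *: (x1 - x0))).
have := @quadratic_nonincreasing _ F 0 1 (k * `|x1 - x0| ^+ 2) ler01.
rewrite /F scale0r scale1r addr0 [x0 + _]addrC subrK; apply => s t _ _ _.
apply: le_trans (gap_quadratic (ltW k0) (JP _) (JP _)) _.
by rewrite opprD addrACA subrr add0r -scalerBl normrZ exprMn real_normK ?num_real//
  mulrA mulrAC.
Qed.

(** With [r := `|x - j u|], the subgradient at [u0] bounds [phi u] from below, so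
    the bound by [M] gives [k * r ^+ 2 <= A + `|f0| * r]; [k] is chosen so large
    that this fails for [e < r]. *)
Lemma supports_approx k0 f0 u0 (x : H) (M e : R) : 0 <= k0 -> 0 < e ->
  (forall k, k0 <= k -> exists u, supports j phi (k *: (x - j u)) u) ->
  supports j phi f0 u0 ->
  (forall k u, supports j phi (k *: (x - j u)) u ->
    fine (phi u) + k * `|x - j u| ^+ 2 <= M) ->
  exists f u, [/\ supports j phi f u, `|x - j u| <= e & fine (phi u) <= M].
Proof.
move=> k0_ge0 e0 ex s0 leM.
pose A := M - fine (phi u0) - L2dot f0 (x - j u0).
pose k := Num.max k0 ((`|A| / e + `|f0|) / e + 1).
have kk0 : k0 <= k by rewrite le_max lexx.
have [u su] := ex k kk0; exists (k *: (x - j u)), u.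
have k_ge0 : 0 <= k := le_trans k0_ge0 kk0.
have uM := leM _ _ su; split => //; last first.
  by apply: le_trans uM; rewrite lerDl mulr_ge0 ?sqr_ge0.
have [uy _] := su; have lb := supports_le phiNy s0 uy.
set r := `|x - j u| in uM *; rewrite leNgt; apply/negP => er.
have r0 : 0 < r := lt_trans e0 er.
have kr : k * r ^+ 2 <= A + `|f0| * r.
  have := L2dot_le f0 (x - j u); rewrite -/r.
  move: lb; rewrite /A raddfB !L2dotE.
  by move: uM; lra.
have : (`|A| / e + `|f0|) * r < k * r ^+ 2.
  rewrite expr2 mulrA ltr_pM2r//.
  have kgt : (`|A| / e + `|f0|) / e < k.
    by apply: lt_le_trans (_ : _ < (`|A| / e + `|f0|) / e + 1) _;
      rewrite ?ltrDl// le_max lexx orbT.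
  rewrite -ltr_pdivrMr//; apply: le_lt_trans kgt.
  by rewrite ler_wpM2l ?addr_ge0 ?divr_ge0 ?(ltW e0)// lef_pV2 ?posrE// ltW.
rewrite ltNge => /negP; apply; apply: le_trans kr _.
rewrite mulrDl lerD2r; apply: le_trans (ler_norm _) _.
by rewrite mulrAC ler_pdivlMr// ler_wpM2l// ltW.
Qed.

End gap.

Section phiH_as_image.
Context d (T : measurableType d) (R : realType) (mu : {measure set T -> \bar R}).
Local Notation H := (LspaceType2 mu).
Context (V : tvsType R) (j : {linear V -> H}) (phi : V -> \bar R)
  (phiH : H -> \bar R).

(** At points with a subgradient the constancy of the gap is an equality.  In
    general, approximate by minimisers [w] with [j w] close to [x]: with
    [x = j u], lower semicontinuity of [phiH] gives the upper bound; with
    [phiH x] finite, the minimisers stay in a sublevel of [phi] and have a weak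
    cluster point [v], which is the preimage. *)
Theorem phiH_image : weakly_continuous j -> gtNy_functional phi ->
  convex_functional phi -> proper_functional phi -> lsc_functional phi ->
  elliptic j phi -> is_phiH j phi phiH ->
  exists c : R, (forall u, phiH (j u) <= phi u + c%:E)%E /\
    forall x, (phiH x < +oo)%E ->
      exists2 v, j v = x & (phi v + c%:E <= phiH x)%E.
Proof.
move=> jweak phiNy phi_convex prop phi_lsc ell phiH_P.
have [phiHNy phiH_convex _ phiH_lsc _] := phiH_P.
have [k0 k0_ge0 coe] := elliptic_penalized_coercive ell.
have ex x k : k0 <= k -> exists u, supports j phi (k *: (x - j u)) u.
  move=> k0k; apply: (supports_exists jweak) => //; last exact: coe.
  exact: le_trans k0_ge0 k0k.
have [u0 s0] := ex 0 k0 (lexx _); set f0 := _ *: _ in s0.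
pose K := k0 + 1; have K0 : 0 < K by rewrite ltr_wpDl.
have exK x : exists u, supports j phi (K *: (x - j u)) u.
  by apply: ex; rewrite lerDl.
pose c := - gap j phi phiH u0.
have sE f u : supports j phi f u -> phiH (j u) = (fine (phi u) + c)%:E.
  move=> su; have [uHy _] := supports_phiH phiNy phiH_P su.
  rewrite (gtNy_fineK phiHNy uHy); congr EFin.
  have := gap_constant phiNy phiH_P K0 exK s0 su.
  have := gap_constant phiNy phiH_P K0 exK su s0.
  rewrite /c /gap; lra.
exists c; split.
  move=> u; have [uy|] := ltP (phi u) +oo%E; last first.
    by rewrite leye_eq => /eqP ->; rewrite addye// leey.
  rewrite (gtNy_fineK phiNy uy) -EFinD leNgt; apply/negP => ltu.
  have : nbhs (j u) (~` [set y | (phiH y <= (fine (phi u) + c)%:E)%E]).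
    apply: open_nbhs_nbhs; split; first exact/closed_openC/phiH_lsc.
    by apply/negP; rewrite -ltNge.
  rewrite -nbhs_ballE => -[e /= e0 eB].
  have e20 : 0 < e / 2 by rewrite divr_gt0.
  have [|f [w [sw we wu]]] :=
    supports_approx (x := j u) (M := fine (phi u)) phiNy k0_ge0 e20 (ex _) s0.
    move=> k w [wy /(_ (u - w))]; rewrite [(w + _)%R]addrC subrK.
    by rewrite (gtNy_fineK phiNy wy) (gtNy_fineK phiNy uy) -EFinD lee_fin (raddfB j)
      L2dotZl L2dotuu.
  have /eB : ball (j u) e (j w).
    by rewrite -ball_normE/=; apply: le_lt_trans we _; lra.
  by apply; rewrite /= (sE _ _ sw) lee_fin lerD2r.
move=> x xy; pose M := fine (phiH x) - c.
pose A e : set (weak V) := [set w | `|x - j w| <= e /\ (phi w <= M%:E)%E].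
have A0 e : 0 < e -> A e !=set0.
  move=> e0; have [|f [w [sw we wM]]] :=
    supports_approx (x := x) (M := M) phiNy k0_ge0 e0 (ex _) s0.
    move=> k w sw; have [_ /(_ (x - j w))] := supports_phiH phiNy phiH_P sw.
    rewrite [(j w + _)%R]addrC subrK (sE _ _ sw) (gtNy_fineK phiHNy xy).
    by rewrite -EFinD lee_fin L2dotZl L2dotuu /M; lra.
  exists w; split => //; have [wy _] := sw.
  by rewrite (gtNy_fineK phiNy wy) lee_fin.
pose F := filter_from [set e : R | 0 < e] A.
have FF : Filter F.
  apply: filter_from_filter; first by exists 1 => /=.
  move=> e1 e2 /= e10 e20; exists (Num.min e1 e2) => /=; first by rewrite lt_min e10.
  by move=> w [+ wM]; rewrite le_min => /andP[? ?].
have PF : ProperFilter F by apply: filter_from_proper.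
have AE k e : 0 <= k -> 0 < e ->
    A e `<=` [set v | (penalized j phi k x v <= (M + k / 2 * e ^+ 2)%:E)%E].
  move=> k_ge0 e0 w [we wM] /=; rewrite EFinD leeD// lee_fin.
  rewrite ler_wpM2l ?divr_ge0// distrC.
  by rewrite ler_sqr ?nnegrE// ltW.
have [|v Fv] := coe k0 (lexx _) x (M + k0 / 2 * 1 ^+ 2) F PF.
  by exists 1 => /=; [exact: ltr01|exact: AE].
have vle k e : 0 <= k -> 0 < e ->
    (penalized j phi k x v <= (M + k / 2 * e ^+ 2)%:E)%E.
  move=> k_ge0 e0; apply: (penalized_weakly_closed jweak phiNy phi_convex phi_lsc k_ge0).
  move: Fv; rewrite clusterE; apply; exists e => //; exact: AE.
have vM : (phi v <= M%:E)%E.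
  have := vle 0 1 (lexx _) ltr01.
  by rewrite /penalized !mul0r addr0; case: (phi v) => [r||]//=; rewrite addr0.
have vy : (phi v < +oo)%E := le_lt_trans vM (ltry _).
exists v; last first.
  rewrite (gtNy_fineK phiHNy xy); move: vM.
  by rewrite (gtNy_fineK phiNy vy) -EFinD !lee_fin /M lerBrDr.
(* If [n := `|j v - x|] were positive, then the bound [vle] with [e := n / 2]
   would fail for a large penalty, [k := 4 * (m + 1) / n ^+ 2]. *)
apply/eqP; rewrite -subr_eq0 -normr_eq0 eq_le normr_ge0 andbT leNgt.
apply/negP => n0; set n := `|_| in n0.
pose m := M - fine (phi v).
have m0 : 0 <= m by rewrite subr_ge0 -lee_fin -(gtNy_fineK phiNy vy).
pose k := 4 * (m + 1) / n ^+ 2.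
have n20 : 0 < n ^+ 2 by rewrite exprn_gt0.
have k_ge0 : 0 <= k by rewrite divr_ge0 ?(ltW n20)// mulr_ge0// addr_ge0.
have := vle k (n / 2) k_ge0 (divr_gt0 n0 (ltr0n _ 2)).
rewrite penalized_fin// lee_fin -/n.
have -> : k / 2 * n ^+ 2 = 2 * (m + 1) by rewrite /k; field; rewrite gt_eqF.
have -> : k / 2 * (n / 2) ^+ 2 = (m + 1) / 2 by rewrite /k; field; rewrite gt_eqF.
rewrite /m in m0 *; lra.
Qed.

End phiH_as_image.

(** * The fundamental theorem of calculus for weak derivatives *)

Section ae_integral.
Local Open Scope ereal_scope.
Context d (T : measurableType d) (R : realType) (mu : {measure set T -> \bar R}).
Import HBNNSimple.

Let ge0_ae_le_integralT (f g : T -> \bar R) :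
  (forall x, 0 <= f x) -> (forall x, 0 <= g x) ->
  (\forall x \ae mu, f x <= g x) -> \int[mu]_x f x <= \int[mu]_x g x.
Proof.
move=> f0 g0 [N [mN N0 subN]].
rewrite !ge0_integralTE//; apply: ge_ereal_sup => _ [/= h hf <-].
pose h' := proj_nnsfun h (measurableC mN).
have h'E x : h' x = if x \in ~` N then h x else 0%R by rewrite -mrestrict.
apply: ereal_sup_ubound; exists h'.
  move=> x; rewrite h'E; case: ifPn => // /set_mem Nx.
  apply: le_trans (hf x) _; apply: contrapT => fg.
  by apply: Nx; exact: subN.
rewrite -!integralT_nnsfun; apply: ge0_ae_eq_integral => //.
- by apply/measurable_EFinP.
- by apply/measurable_EFinP.
- by move=> x _; rewrite lee_fin.
- by move=> x _; rewrite lee_fin.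
exists N; split => // x; apply: contra_notP => Nx _.
by rewrite h'E mem_set.
Qed.

(** The integral is defined by suprema over simple functions, which can be
    cut off on a null set; so neither function has to be measurable.  This is
    what allows a weak derivative to be exchanged for a measurable version. *)
Lemma ae_eq_integralW (D : set T) (f g : T -> \bar R) :
  (\forall x \ae mu, D x -> f x = g x) ->
  \int[mu]_(x in D) f x = \int[mu]_(x in D) g x.
Proof.
move=> fg; rewrite integral_mkcond [RHS]integral_mkcond.
have {fg} : \forall x \ae mu, (f \_ D) x = (g \_ D) x.
  apply: filterS fg => x fg; rewrite !patchE.
  by case: ifPn => // /set_mem /fg.
move: (f \_ D) (g \_ D) => {}f {}g fg; rewrite integralE [RHS]integralE.
by congr (_ - _); apply/eqP; rewrite eq_le;
  apply/andP; split; apply: ge0_ae_le_integralT => //;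
  apply: filterS fg => x; rewrite ?funeposE ?funenegE => ->.
Qed.

End ae_integral.

Lemma ae_eq_RintegralW d (T : measurableType d) (R : realType)
    (mu : {measure set T -> \bar R}) (D : set T) (f g : T -> R) :
  (\forall x \ae mu, D x -> f x = g x) ->
  \int[mu]_(x in D) f x = \int[mu]_(x in D) g x.
Proof.
move=> fg; congr fine; apply: ae_eq_integralW.
by apply: filterS fg => x fg Dx; rewrite fg.
Qed.

Lemma Rintegral_restrict d (T : measurableType d) (R : realType)
    (mu : {measure set T -> \bar R}) (D E : set T) (f : T -> R) :
  D `<=` E -> (forall x, E x -> ~ D x -> f x = 0) ->
  \int[mu]_(x in E) f x = \int[mu]_(x in D) f x.
Proof.
move=> DE f0; rewrite Rintegral_mkcond [RHS]Rintegral_mkcond.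
congr Rintegral; apply/funext => x; rewrite !patchE.
case: ifPn => [/set_mem Ex|nE]; case: ifPn => //.
  by move=> /negP nD; rewrite f0// => Dx; apply: nD; exact/mem_set.
by move=> /set_mem/DE/mem_set xE; rewrite xE in nE.
Qed.

Section almost_everywhere.
Context d (T : measurableType d) (R : realType) (mu : {measure set T -> \bar R}).

Lemma ae_mono (P Q : T -> Prop) : (forall x, P x -> Q x) ->
  (\forall x \ae mu, P x) -> \forall x \ae mu, Q x.
Proof. by move=> PQ; apply: filterS. Qed.

Lemma ae_and (P Q : T -> Prop) : (\forall x \ae mu, P x) ->
  (\forall x \ae mu, Q x) -> \forall x \ae mu, P x /\ Q x.
Proof. by move=> HP HQ; exact: filterI. Qed.

End almost_everywhere.

Section cutoff.
Context (R : realType).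
Implicit Types (r h e c : R).

(** A quadratic bound on the Taylor remainder spares a case analysis at the
    points where the second derivative jumps. *)
Lemma is_derive_quadratic_error (f : R -> R) (x l C : R) :
  (forall h, `|f (h + x) - f x - l * h| <= C * h ^+ 2) ->
  is_derive x 1 f l.
Proof.
move=> H.
have C0 : 0 <= C by have := le_trans (normr_ge0 _) (H 1); rewrite expr1n mulr1.
have dl : h^-1 *: ((f \o shift x) (h *: 1) - f x) @[h --> (0 : R)^'] --> l.
  apply/cvgrPdist_lt => e e0; near=> h.
  have h0 : h != 0 by near: h; exact: nbhs_dnbhs_neq.
  have -> : l - h^-1 *: ((f \o shift x) (h *: 1) - f x) =
      - (h^-1 * (f (h + x) - f x - l * h)).
    by rewrite /= scaler1 -[_ *: _]/(h^-1 * (f (h + x) - f x)); field.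
  rewrite normrN normrM normfV; apply: le_lt_trans (_ : `|h|^-1 * (C * h ^+ 2) < e).
    by rewrite ler_wpM2l// invr_ge0.
  rewrite -[h ^+ 2]real_normK ?num_real// mulrCA expr2 mulKf ?normr_eq0//.
  apply: le_lt_trans (_ : (C + 1) * `|h| < e).
    by rewrite ler_wpM2r// lerDl.
  rewrite -ltr_pdivlMl ?ltr_wpDl//.
  near: h; apply: dnbhs0_lt; rewrite mulr_gt0// invr_gt0 ltr_wpDl//.
have dv : derivable f x 1 by apply/cvg_ex; exists l.
by apply: DeriveDef => //; exact/cvg_lim.
Unshelve. all: by end_near. Qed.

(** The square of the positive part, the building block of the cutoffs: it is
    [C^1], with derivative [2 * Num.max r 0]. *)
Definition possq r : R := Num.max r 0 ^+ 2.

Lemma possq_error x h :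
  `|possq (h + x) - possq x - 2 * Num.max x 0 * h| <= h ^+ 2.
Proof.
rewrite /possq ler_norml /Num.max.
by case: (ltP x 0) => ?; case: (ltP (h + x) 0) => ?; apply/andP; split; nra.
Qed.

(** A [C^1] function that rises from [0] at [c] to [1] at [c + 2 * e]: the second
    difference of [possq] with step [e], normalised. *)
Definition ramp e c r : R :=
  (possq (r - c) - 2 * possq (r - c - e) + possq (r - c - 2 * e)) / (2 * e ^+ 2).

(** The derivative of [ramp e c]: a hat function of integral [1], supported in
    [[c, c + 2 * e]]. *)
Definition tent e c r : R :=
  (Num.max (r - c) 0 - 2 * Num.max (r - c - e) 0 + Num.max (r - c - 2 * e) 0)
  / e ^+ 2.

Lemma ramp_error e c r h : 0 < e ->
  `|ramp e c (h + r) - ramp e c r - tent e c r * h| <= 2 / e ^+ 2 * h ^+ 2.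
Proof.
move=> e0.
have := possq_error (r - c) h; have := possq_error (r - c - e) h.
have := possq_error (r - c - 2 * e) h.
rewrite !addrA.
have -> : ramp e c (h + r) - ramp e c r - tent e c r * h =
  ((possq (h + r - c) - possq (r - c) - 2 * Num.max (r - c) 0 * h)
   - 2 * (possq (h + r - c - e) - possq (r - c - e)
          - 2 * Num.max (r - c - e) 0 * h)
   + (possq (h + r - c - 2 * e) - possq (r - c - 2 * e)
          - 2 * Num.max (r - c - 2 * e) 0 * h)) / (2 * e ^+ 2).
  by rewrite /ramp /tent; field; rewrite gt_eqF.
set A := _ - _ - _; set B := _ - _ - _; set E := _ - _ - _ => hA hB hE.
have e20 : 0 < e ^+ 2 by rewrite exprn_gt0.
rewrite normrM normfV [`|2 * e ^+ 2|]gtr0_norm ?mulr_gt0//.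
rewrite ler_pdivrMr ?mulr_gt0//.
have -> : 2 / e ^+ 2 * h ^+ 2 * (2 * e ^+ 2) = 4 * h ^+ 2.
  by field; rewrite gt_eqF.
move: hA hB hE; rewrite !ler_norml => /andP[? ?] /andP[? ?] /andP[? ?].
by apply/andP; split; lra.
Qed.

Lemma is_derive_ramp e c r : 0 < e -> is_derive r 1 (ramp e c) (tent e c r).
Proof.
by move=> e0; apply: is_derive_quadratic_error => h; exact: ramp_error.
Qed.

Lemma tent_ge0 e c r : 0 < e -> 0 <= tent e c r.
Proof.
move=> e0; rewrite /tent divr_ge0 ?sqr_ge0// /Num.max.
by case: (ltP (r - c) 0) => ?; case: (ltP (r - c - e) 0) => ?;
  case: (ltP (r - c - 2 * e) 0) => ?; lra.
Qed.

Lemma tent_out e c r : 0 < e -> (r <= c) || (c + 2 * e <= r) -> tent e c r = 0.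
Proof.
move=> e0 H; rewrite /tent; apply/eqP; rewrite mulf_eq0; apply/orP; left.
apply/eqP; rewrite /Num.max; case/orP : H => H;
by case: (ltP (r - c) 0) => ?; case: (ltP (r - c - e) 0) => ?;
  case: (ltP (r - c - 2 * e) 0) => ?; lra.
Qed.

Lemma ramp_l e c r : 0 < e -> r <= c -> ramp e c r = 0.
Proof.
move=> e0 H; rewrite /ramp; apply/eqP; rewrite mulf_eq0; apply/orP; left.
apply/eqP; rewrite /possq /Num.max.
by case: (ltP (r - c) 0) => ?; case: (ltP (r - c - e) 0) => ?;
  case: (ltP (r - c - 2 * e) 0) => ?; nra.
Qed.

Lemma ramp_r e c r : 0 < e -> c + 2 * e <= r -> ramp e c r = 1.
Proof.
move=> e0 H; rewrite /ramp /possq !max_l; [|lra|lra|lra].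
by field; rewrite gt_eqF.
Qed.

Lemma ramp_01 e c r : 0 < e -> 0 <= ramp e c r <= 1.
Proof.
move=> e0; have e20 : 0 < 2 * e ^+ 2 by rewrite mulr_gt0 ?exprn_gt0.
rewrite /ramp divr_ge0 ?(ltW e20)/=; first rewrite ler_pdivrMr// mul1r.
all: rewrite /possq /Num.max; case: (ltP (r - c) 0) => ?; case: (ltP (r - c - e) 0) => ?;
  case: (ltP (r - c - 2 * e) 0) => ?; nra.
Qed.

Lemma continuous_tent e c : continuous (tent e c).
Proof.
have cmax a : continuous (fun r => Num.max (r - a) 0 : R).
  move=> r; apply: (@continuous_max R R (fun r => r - a) (cst 0)).
    by apply: cvgB; [exact: cvg_id|exact: cvg_cst].
  exact: cvg_cst.
move=> r; rewrite /tent; apply: cvgM; last exact: cvg_cst.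
apply: cvgD; last first.
  by under eq_fun do rewrite -addrA -opprD; rewrite -addrA -opprD; exact: cmax.
apply: cvgB; first exact: cmax.
apply: cvgM; first exact: cvg_cst.
by under eq_fun do rewrite -addrA -opprD; rewrite -addrA -opprD; exact: cmax.
Qed.

Lemma Rintegral_tent e c s t : 0 < e -> s <= c -> c + 2 * e <= t ->
  \int[lebesgue_measure]_(r in `[s, t]) tent e c r = 1.
Proof.
move=> e0 sc ct; have st : s < t by lra.
rewrite /Rintegral (@continuous_FTC2 _ _ (ramp e c))//.
- by rewrite ramp_r// (@ramp_l _ _ s)// sube0.
- by apply: continuous_subspaceT; exact: continuous_tent.
- have cr r : {for r, continuous (ramp e c)}.
    apply/differentiable_continuous/derivable1_diffP.
    by have [] := is_derive_ramp c r e0.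
  split => [r _||].
  + by have [] := is_derive_ramp c r e0.
  + exact/cvg_at_right_filter/cr.
  + exact/cvg_at_left_filter/cr.
- by move=> r _; rewrite derive1E; have [_ ->] := is_derive_ramp c r e0.
Qed.

End cutoff.

Section weak_FTC.
Context (R : realType).
Local Notation leb := (@lebesgue_measure R).
Implicit Types (r e c s t : R) (w g : R -> R).

Lemma within_integrable w s t : {within `[s, t], continuous w} ->
  leb.-integrable `[s, t] (EFin \o w).
Proof. by apply: continuous_compact_integrable; exact: segment_compact. Qed.

Lemma within_mul w g s t : {within `[s, t], continuous w} -> continuous g ->
  {within `[s, t], continuous (fun r => g r * w r)}.
Proof.
move=> cw cg r.
have cg' : {within `[s, t], continuous g} by exact: continuous_subspaceT.
exact: cvgM (cg' r) (cw r).
Qed.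

(** The tent is a probability density. *)
Lemma tent_average w s t c e y (dl : R) : 0 < e -> s <= c -> c + 2 * e <= t ->
  {within `[s, t], continuous w} ->
  (forall r, c <= r <= c + 2 * e -> `|w r - y| <= dl) ->
  `|\int[leb]_(r in `[s, t]) (tent e c r * w r) - y| <= dl.
Proof.
move=> e0 sc ct cw wy.
have ct_ := @continuous_tent R e c.
have it : leb.-integrable `[s, t] (EFin \o tent e c).
  by apply: within_integrable; exact: continuous_subspaceT.
have itw : leb.-integrable `[s, t] (EFin \o (fun r => tent e c r * w r)).
  by apply: within_integrable; exact: within_mul.
have ity : leb.-integrable `[s, t] (EFin \o (fun r => tent e c r * y)).
  apply: within_integrable; apply: within_mul => //.
  by apply: continuous_subspaceT; exact: cst_continuous.
have -> : \int[leb]_(r in `[s, t]) (tent e c r * w r) - y =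
    \int[leb]_(r in `[s, t]) (tent e c r * (w r - y)).
  under [RHS]eq_Rintegral do rewrite mulrBr.
  by rewrite RintegralB// RintegralZr// Rintegral_tent// mul1r.
have cwy : {within `[s, t], continuous (fun r => w r - y)}.
  by move=> r; apply: cvgB; [exact: cw|exact: cvg_cst].
have itwy := within_integrable (within_mul cwy ct_).
apply: le_trans (le_normr_Rintegral _ itwy) _ => //.
apply: le_trans (_ : \int[leb]_(r in `[s, t]) (tent e c r * dl) <= _); last first.
  by rewrite RintegralZr// Rintegral_tent// mul1r.
apply: le_Rintegral => //.
- exact: (integrable_norm itwy).
- apply: within_integrable; apply: within_mul => //.
  by apply: continuous_subspaceT; exact: cst_continuous.
move=> r _; rewrite normrM (ger0_norm (tent_ge0 _ _ e0)).
have [rc|cr] := leP r c; first by rewrite tent_out ?rc// !mul0r.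
have [tr|rt] := leP (c + 2 * e) r; first by rewrite tent_out ?tr ?orbT// !mul0r.
by rewrite ler_wpM2l ?tent_ge0// wy// !ltW.
Qed.

(** A [C^1] approximation of the indicator of [[s, t]] from inside. *)
Definition cutoff s t e r : R := ramp e s r - ramp e (t - 2 * e) r.

Lemma is_derive_cutoff s t e r : 0 < e ->
  is_derive r 1 (cutoff s t e) (tent e s r - tent e (t - 2 * e) r).
Proof.
move=> e0; have d1 := is_derive_ramp s r e0.
have d2 := is_derive_ramp (t - 2 * e) r e0.
exact: (is_deriveB d1 d2).
Qed.

Lemma derive1_cutoff s t e : 0 < e ->
  derive1 (cutoff s t e) = (fun r => tent e s r - tent e (t - 2 * e) r).
Proof.
move=> e0; apply/funext => r; rewrite derive1E.
by have [_ ->] := is_derive_cutoff s t r e0.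
Qed.

Lemma cutoff_out s t e r : 0 < e -> s + 2 * e <= t - 2 * e ->
  r \notin `[s, t] -> cutoff s t e r = 0.
Proof.
move=> e0 st; rewrite in_itv/= negb_and -!ltNge => /orP[rs|tr]; rewrite /cutoff.
  by rewrite !ramp_l ?subrr//; lra.
by rewrite !ramp_r ?subrr//; lra.
Qed.

Lemma cutoff_01 s t e r : 0 < e -> s + 2 * e <= t - 2 * e ->
  0 <= 1 - cutoff s t e r <= 1.
Proof.
move=> e0 st; rewrite /cutoff; have /andP[a0 a1] := ramp_01 s r e0.
have /andP[b0 b1] := ramp_01 (t - 2 * e) r e0.
have [rt|tr] := leP r (t - 2 * e); first by rewrite (@ramp_l _ _ (t - 2 * e))//; lra.
by rewrite (@ramp_r _ _ s)//; lra.
Qed.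

Lemma cutoff_mid s t e r : 0 < e -> s + 2 * e <= r -> r <= t - 2 * e ->
  cutoff s t e r = 1.
Proof. by move=> e0 sr rt; rewrite /cutoff ramp_r// ramp_l// subr0. Qed.

Lemma test_function_cutoff s t e : 0 < e -> s + 2 * e <= t - 2 * e -> 0 < s ->
  test_function (cutoff s t e).
Proof.
move=> e0 st s0; split.
- by move=> r; have [] := is_derive_cutoff s t r e0.
- rewrite derive1_cutoff// => r; apply: cvgB; exact: continuous_tent.
- by exists (s, t) => //= r; exact: cutoff_out.
Qed.

Lemma within_right w s t (dl : R) : s < t -> {within `[s, t], continuous w} ->
  0 < dl -> exists2 e, 0 < e & forall r, s <= r <= s + e -> `|w r - w s| <= dl.
Proof.
move=> st cw dl0; have [_ ws _] := (continuous_within_itvP _ st).1 cw.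
have [e /= e0 H] := (cvgrPdist_le _ _).1 ws dl dl0.
exists (e / 2) => [|r /andP[]]; first by rewrite divr_gt0.
rewrite le_eqVlt => /predU1P[<- _|sr rs]; first by rewrite subrr normr0 ltW.
rewrite distrC; apply: H => //=.
by rewrite distrC gtr0_norm ?subr_gt0//; lra.
Qed.

Lemma within_left w s t (dl : R) : s < t -> {within `[s, t], continuous w} ->
  0 < dl -> exists2 e, 0 < e & forall r, t - e <= r <= t -> `|w r - w t| <= dl.
Proof.
move=> st cw dl0; have [_ _ wt] := (continuous_within_itvP _ st).1 cw.
have [e /= e0 H] := (cvgrPdist_le _ _).1 wt dl dl0.
exists (e / 2) => [|r /andP[tr]]; first by rewrite divr_gt0.
rewrite le_eqVlt => /predU1P[->|rt]; first by rewrite subrr normr0 ltW.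
rewrite distrC; apply: H => //=.
by rewrite gtr0_norm ?subr_gt0//; lra.
Qed.

Lemma bounded_integrable g s t (M : R) : measurable_fun setT g ->
  (forall r, r \in `[s, t] -> `|g r| <= M) ->
  leb.-integrable `[s, t] (EFin \o g).
Proof.
move=> mg gM; apply: measurable_bounded_integrable => //.
- by rewrite /= lebesgue_measure_itv/=; case: ifP => // _; rewrite -EFinB ltry.
- exact: measurable_funS mg.
- exists M; split; first exact: num_real.
  by move=> m Mm r /= rD; apply: le_trans (gM _ rD) (ltW Mm).
Qed.

Lemma Rintegral_indic_itv s t a b : s <= a -> a <= b -> b <= t ->
  \int[leb]_(r in `[s, t]) \1_(`[a, b]) r = b - a.
Proof.
move=> sa ab bt; rewrite /Rintegral integral_indic//.
rewrite (_ : _ `&` _ = `[a, b]%classic); last first.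
  apply/setIidPl => r /=; rewrite !in_itv/= => /andP[? ?].
  by apply/andP; split; lra.
rewrite /= lebesgue_measure_itv/= lte_fin.
by case: ltgtP ab => // ->; rewrite subrr.
Qed.

Lemma indic_integrable s t a b : leb.-integrable `[s, t] (EFin \o \1_(`[a, b])).
Proof.
apply: (@bounded_integrable _ _ _ 1) => [|r _]; first exact: measurable_indic.
by rewrite indicE ger0_norm ?ler0n// lern1 leq_b1.
Qed.

(** The cutoff differs from [1] only on two subintervals of [[s, t]] of length [2 * e]. *)
Lemma cutoff_error g s t e (M : R) : 0 < e -> s + 2 * e <= t - 2 * e ->
  0 <= M -> measurable_fun setT g ->
  (forall r, r \in `[s, t] -> `|g r| <= M) ->
  `|\int[leb]_(r in `[s, t]) g r -
    \int[leb]_(r in `[s, t]) (cutoff s t e r * g r)| <= 4 * e * M.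
Proof.
move=> e0 st M0 mg gM.
have ig := bounded_integrable mg gM.
have mc : measurable_fun setT (cutoff s t e).
  apply: continuous_measurable_fun => r.
  apply/differentiable_continuous/derivable1_diffP.
  by have [] := is_derive_cutoff s t r e0.
have icg : leb.-integrable `[s, t] (EFin \o (fun r => cutoff s t e r * g r)).
  apply: (@bounded_integrable _ _ _ M); first exact: measurable_funM.
  move=> r rst; rewrite normrM -[leRHS]mul1r ler_pM// ?gM//.
  by have /andP[? ?] := cutoff_01 r e0 st; rewrite ler_norml; lra.
rewrite -RintegralB//; pose A := `[s, s + 2 * e]; pose B := `[t - 2 * e, t].
have iA : leb.-integrable `[s, t] (EFin \o \1_[set` A]) by exact: indic_integrable.
have iB : leb.-integrable `[s, t] (EFin \o \1_[set` B]) by exact: indic_integrable.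
have iAB : leb.-integrable `[s, t] (EFin \o (fun r => \1_[set` A] r + \1_[set` B] r)).
  exact: (integrableD _ iA iB).
have iM : leb.-integrable `[s, t]
    (EFin \o (fun r => M * (\1_[set` A] r + \1_[set` B] r))).
  exact: (integrableZl _ M iAB).
apply: le_trans (_ : \int[leb]_(r in `[s, t]) (M * (\1_[set` A] r + \1_[set` B] r)) <= _);
  last first.
  by rewrite RintegralZl// RintegralD// !Rintegral_indic_itv; lra.
have ign : leb.-integrable `[s, t] (EFin \o (fun r => g r - cutoff s t e r * g r)).
  exact: (integrableB _ ig icg).
apply: le_trans (le_normr_Rintegral _ ign) _ => //.
apply: le_Rintegral => //; first exact: (integrable_norm ign).
move=> r rst; rewrite -[X in `|X - _|]mul1r -mulrBl normrM mulrC.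
have /andP[c0 c1] := cutoff_01 r e0 st; rewrite (ger0_norm c0).
rewrite ler_pM// ?gM// !indicE !mem_setE !in_itv/=.
have /andP[-> ->] : s <= r <= t by move: rst; rewrite /= in_itv.
rewrite andbT /=; have [rs|sr] := leP r (s + 2 * e).
  by apply: le_trans c1 _; rewrite lerDl ler0n.
have [tr|rt] := leP (t - 2 * e) r; first by rewrite add0r.
by rewrite cutoff_mid ?subrr ?addr0// ltW.
Qed.

(** Test with [cutoff s t e].  Its derivative is a tent at [s] minus a tent at [t],
    so as [e] tends to [0] the integral against [w] tends to [w s - w t] and the
    integral of [cutoff * g'] to that of [g']. *)
Theorem weak_FTC w g g' s t (M : R) : 0 < s -> s < t ->
  {within `[s, t], continuous w} ->
  (forall theta, test_function theta ->
    \int[leb]_(r in `]0, +oo[) (derive1 theta r * w r) =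
    - \int[leb]_(r in `]0, +oo[) (theta r * g r)) ->
  measurable_fun setT g' -> (forall r, r \in `[s, t] -> `|g' r| <= M) ->
  (\forall r \ae leb, 0 < r -> g r = g' r) ->
  w t - w s = \int[leb]_(r in `[s, t]) g' r.
Proof.
move=> s0 st cw weak mg' g'M gg'.
have M0 : 0 <= M.
  by apply: le_trans (normr_ge0 (g' s)) (g'M _ _); rewrite in_itv/= lexx ltW.
apply/eqP; rewrite -subr_eq0 -normr_eq0 eq_le normr_ge0 andbT.
apply/ler_addgt0Pl => z z0; rewrite addr0.
pose dl := z / (2 + 4 * M).
have M40 : 0 < 2 + 4 * M by rewrite ltr_pwDl// mulr_ge0.
have dl0 : 0 < dl by rewrite divr_gt0.
have [e1 e10 H1] := within_right st cw dl0.
have [e2 e20 H2] := within_left st cw dl0.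
pose e := Num.min dl (Num.min (Num.min (e1 / 2) (e2 / 2)) ((t - s) / 4)).
have e0 : 0 < e by rewrite !lt_min dl0 !divr_gt0// subr_gt0.
have edl : e <= dl by rewrite ge_min lexx.
have ee1 : 2 * e <= e1.
  by rewrite -ler_pdivlMl// mulrC !ge_min lexx !orbT.
have ee2 : 2 * e <= e2.
  by rewrite -ler_pdivlMl// mulrC !ge_min lexx !orbT.
have est : 4 * e <= t - s.
  by rewrite -ler_pdivlMl// mulrC !ge_min lexx !orbT.
have st4 : s + 2 * e <= t - 2 * e by lra.
have := weak _ (test_function_cutoff e0 st4 s0).
have sub : ([set` `[s, t]] : set R) `<=` [set` `]0, +oo[].
  by move=> r /=; rewrite !in_itv/= => /andP[sr _]; rewrite andbT (lt_le_trans s0).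
have -> : \int[leb]_(r in `]0, +oo[) (derive1 (cutoff s t e) r * w r) =
    \int[leb]_(r in `[s, t]) (derive1 (cutoff s t e) r * w r).
  apply: Rintegral_restrict => // r _ /negP rst; rewrite derive1_cutoff//.
  move: rst; rewrite in_itv/= negb_and -!ltNge => /orP[rs|tr].
    by rewrite !tent_out ?subrr ?mul0r//; apply/orP; left; lra.
  by rewrite !tent_out ?subrr ?mul0r//; apply/orP; right; lra.
have -> : \int[leb]_(r in `]0, +oo[) (cutoff s t e r * g r) =
    \int[leb]_(r in `[s, t]) (cutoff s t e r * g' r).
  rewrite (@Rintegral_restrict _ _ _ leb `[s, t])//; last first.
    by move=> r _ /negP rst; rewrite cutoff_out ?mul0r.
  apply: ae_eq_RintegralW; apply: ae_mono gg' => r gg' rst; rewrite gg'//.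
  by have /sub := rst; rewrite /= in_itv/= andbT.
rewrite derive1_cutoff//.
under [in X in X = _ -> _]eq_Rintegral do rewrite mulrBl.
have iw c : leb.-integrable `[s, t] (EFin \o (fun r => tent e c r * w r)).
  by apply: within_integrable; apply: within_mul => //; exact: continuous_tent.
rewrite RintegralB// => eq.
have A1 : `|\int[leb]_(r in `[s, t]) (tent e s r * w r) - w s| <= dl.
  apply: tent_average => //; first by lra.
  by move=> r /andP[? ?]; apply: H1; apply/andP; split; lra.
have A2 : `|\int[leb]_(r in `[s, t]) (tent e (t - 2 * e) r * w r) - w t| <= dl.
  apply: tent_average => //; [by lra|by lra|].
  by move=> r /andP[? ?]; apply: H2; apply/andP; split; lra.
have A3 := cutoff_error e0 st4 M0 mg' g'M.
have A4 : 4 * e * M <= 4 * dl * M by rewrite ler_wpM2r// ler_wpM2l.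
(* The two tents contribute [dl] each, the cutoff [4 * e * M]. *)
have zE : z = 2 * dl + 4 * dl * M by rewrite /dl; field; rewrite gt_eqF.
move: A1 A2 A3 eq; rewrite !ler_norml.
move=> /andP[? ?] /andP[? ?] /andP[? ?] ?; apply/andP; split; lra.
Qed.

End weak_FTC.

(** * Curves in L2 with a weak derivative *)

Section weakly_differentiable_curves.
Context d (T : measurableType d) (R : realType) (mu : {measure set T -> \bar R}).
Local Notation H := (LspaceType2 mu).
Local Notation leb := (@lebesgue_measure R).
Implicit Types (u g : R -> H) (h : H) (r s t M : R).

Lemma simple_dot_measurable (f : R -> H) h : finite_set (range f) ->
  (forall v, measurable (f @^-1` [set v])) ->
  measurable_fun setT (fun r => L2dot (f r) h).
Proof.
move=> finf mf _ Y mY; rewrite setTI.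
rewrite (_ : _ @^-1` Y =
    \bigcup_(v in range f `&` [set v | Y (L2dot v h)]) (f @^-1` [set v])).
  apply: fin_bigcup_measurable; first exact: finite_setIl.
  by move=> v _; exact: mf.
apply/seteqP; split => [r Yr|r [v [_ /= Yv] /= fr]].
  by exists (f r) => //; split => //; exists r.
by rewrite fr.
Qed.

(** Off a null set [L2dot (g r) h] is a limit of measurable simple functions and
    obeys the bound; where this fails, [g'] is set to [0]. *)
Lemma strongly_measurable_dot g h s t M : strongly_measurable g -> 0 <= M ->
  (\forall r \ae leb, r \in `[s, t] -> `|g r| <= M) ->
  exists g' : R -> R, [/\ measurable_fun setT g',
    forall r, r \in `[s, t] -> `|g' r| <= M * `|h| &
    \forall r \ae leb, 0 < r -> L2dot (g r) h = g' r].
Proof.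
move=> [f [fS fcv]] M0 gM.
have [N [mN N0 subN]] := ae_and fcv gM.
pose D := [set r : R | 0 < r] `&` ~` N.
have mD : measurable D.
  apply: measurableI; last exact: measurableC.
  by rewrite -[X in measurable X]set_itvoy; exact: measurable_itv.
have DP r : D r -> (f ^~ r @ \oo --> g r) /\ (r \in `[s, t] -> `|g r| <= M).
  move=> [r0 /= Nr]; have [] := contrapT (fun H => Nr (subN r H)).
  by move=> /(_ r0).
exists ((fun r => L2dot (g r) h) \_ D); split.
- apply/(measurable_restrictT _ mD).
  apply: (measurable_fun_cvg (h := fun n r => L2dot (f n r) h)).
    move=> n; apply: measurable_funS (simple_dot_measurable h (fS n).1 (fS n).2) => //.
  move=> r /DP[+ _] => cv.
  exact: (cvg_comp (fun n => f n r) (fun v => L2dot v h) cv (@L2dotr_continuous _ _ _ mu h (g r))).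
- move=> r rst; rewrite patchE; case: ifPn => [/set_mem/DP[_ gr]|_].
    by apply: le_trans (L2dot_norm _ _) _; rewrite ler_wpM2r// gr.
  by rewrite normr0 mulr_ge0.
- exists N; split => // r /= /not_implyP[r0]; apply: contra_notP => Nr.
  by rewrite patchE mem_set.
Qed.

Lemma within_dot u h s t : {within `[0, +oo[, continuous u} -> 0 <= s ->
  {within `[s, t], continuous (fun r => L2dot (u r) h)}.
Proof.
move=> cu s0.
have cu' : {within `[s, t], continuous u}.
  apply: continuous_subspaceW cu => r /=; rewrite !in_itv/= andbT => /andP[+ _].
  exact: le_trans.
move=> r; exact: (cvg_comp u (fun v => L2dot v h) (cu' r) (@L2dotr_continuous _ _ _ mu h (u r))).
Qed.

Definition curve u g := [/\ {within `[0, +oo[, continuous u}, Loo_loc g &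
  weak_derivative u g].

Lemma curve_bound u g s t : curve u g -> 0 < s ->
  exists2 M, 0 <= M & \forall r \ae leb, r \in `[s, t] -> `|g r| <= M.
Proof.
move=> [_ [_ /(_ s t)gM] _] s0; have [M HM] := gM s0.
exists `|M| => //; apply: ae_mono HM => r + rst => /(_ rst) /le_trans; apply.
exact: ler_norm.
Qed.

(** The vector [h] turns the weak derivative into a scalar one. *)
Lemma curve_FTC u g h s t M : curve u g -> 0 < s -> s < t -> 0 <= M ->
  (\forall r \ae leb, r \in `[s, t] -> `|g r| <= M) ->
  exists g' : R -> R, [/\ measurable_fun setT g',
    forall r, r \in `[s, t] -> `|g' r| <= M * `|h|,
    \forall r \ae leb, r \in `[s, t] -> L2dot (g r) h = g' r &
    L2dot (u t - u s) h = \int[leb]_(r in `[s, t]) g' r].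
Proof.
move=> [cu [mg _] wd] s0 st M0 gM.
have [g' [mg' g'M gg']] := strongly_measurable_dot h mg M0 gM.
exists g'; split => //.
  apply: ae_mono gg' => r + rst; apply.
  by move: rst; rewrite in_itv/= => /andP[+ _]; exact: lt_le_trans.
rewrite L2dotBl; apply: (@weak_FTC _ (fun r => L2dot (u r) h)
  (fun r => L2dot (g r) h) g' s t (M * `|h|)) => //.
  exact: within_dot cu (ltW s0).
by move=> theta Htheta; exact: wd.
Qed.

(** The form in which weak derivatives enter the sequel: an a.e. bound on the
    derivative, paired with fixed vectors, integrates to a bound on the
    increments. *)
Theorem curve_pair_le u1 g1 u2 g2 h1 h2 s t K : curve u1 g1 -> curve u2 g2 ->
  0 < s -> s <= t ->
  (\forall r \ae leb, r \in `[s, t] -> L2dot (g1 r) h1 + L2dot (g2 r) h2 <= K) ->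
  L2dot (u1 t - u1 s) h1 + L2dot (u2 t - u2 s) h2 <= K * (t - s).
Proof.
move=> c1 c2 s0; rewrite le_eqVlt => /predU1P[<- _|st leK].
  by rewrite !subrr !L2dot0l addr0 mulr0.
have [M1 M10 gM1] := curve_bound t c1 s0.
have [M2 M20 gM2] := curve_bound t c2 s0.
have [f1 [mf1 f1M gf1 ->]] := curve_FTC h1 c1 s0 st M10 gM1.
have [f2 [mf2 f2M gf2 ->]] := curve_FTC h2 c2 s0 st M20 gM2.
rewrite -RintegralD//; [|exact: bounded_integrable mf1 f1M|exact: bounded_integrable mf2 f2M].
(* The minimum with [K] makes the a.e. bound hold everywhere. *)
rewrite (@ae_eq_RintegralW _ _ _ leb _ _ (fun r => Num.min (f1 r + f2 r) K)); last first.
  apply: ae_mono (ae_and leK (ae_and gf1 gf2)) => r.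
  by move=> [+ [+ +]] rst => /(_ rst) + /(_ rst) <- /(_ rst) <- => le; rewrite min_l.
have <- : \int[leb]_(r in `[s, t]) K = K * (t - s).
  rewrite Rintegral_cst// /= lebesgue_measure_itv/= lte_fin st.
  by rewrite -EFinB.
apply: le_Rintegral => //.
- apply: (@bounded_integrable _ _ _ _ (M1 * `|h1| + M2 * `|h2| + `|K|)).
    by apply: measurable_minr => //; exact: measurable_funD.
  move=> r rst; have := f1M r rst; have := f2M r rst; rewrite !ler_norml.
  have := ler_norm K; have := ler_norm (- K); rewrite normrN.
  by move=> ? ? /andP[? ?] /andP[? ?]; rewrite /Num.min; case: ltP => ?;
    apply/andP; split; lra.
- by apply: (@bounded_integrable _ _ _ _ `|K|).
- by move=> r _; rewrite ge_min lexx orbT.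
Qed.

(** Pair the increment with itself. *)
Lemma curve_Lipschitz u g s t M : curve u g -> 0 < s -> s <= t -> 0 <= M ->
  (\forall r \ae leb, r \in `[s, t] -> `|g r| <= M) ->
  `|u t - u s| <= M * (t - s).
Proof.
move=> cu s0 st M0 gM; set h := u t - u s.
have := @curve_pair_le u g u g h 0 s t (M * `|h|) cu cu s0 st.
rewrite L2dot0r addr0 L2dotuu => H1.
have {}H1 : `|h| ^+ 2 <= M * `|h| * (t - s).
  apply: H1; apply: ae_mono gM => r gr /gr {}gr; rewrite L2dot0r addr0.
  by apply: le_trans (L2dot_le _ _) _; rewrite ler_wpM2r.
have [->|h0] := eqVneq `|h| 0; first by rewrite mulr_ge0// subr_ge0.
have hp : 0 < `|h| by rewrite lt0r h0 /=.
by rewrite -(ler_pM2r hp) -expr2 mulrAC.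
Qed.

End weakly_differentiable_curves.

(** * The truncations as a projection *)

Section truncation.
Context d (T : measurableType d) (R : realType) (mu : {measure set T -> \bar R}).
Local Notation H := (LspaceType2 mu).
Implicit Types (u v : H) (al : R).

Lemma le_L2norm u v : (\forall x \ae mu, `|u x| <= `|v x|) -> `|u| <= `|v|.
Proof.
move=> uv; rewrite -ler_sqr ?nnegrE// -!L2dotuu; apply: le_L2dot.
apply: ae_mono uv => x uv.
by rewrite -!expr2 -[leLHS]real_normK ?num_real// -[leRHS]real_normK ?num_real//
  ler_sqr ?nnegrE.
Qed.

(** The amount moved by the truncation: half the soft thresholding of [a - b] at
    level [al], as [excessP] shows. *)
Definition excess al (a b : R) : R :=
  a - Num.min (Num.max a ((a + b - al) / 2)) ((a + b + al) / 2).

Lemma excessP al a b : 0 < al ->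
  [\/ - al <= a - b <= al /\ excess al a b = 0,
      al < a - b /\ excess al a b = (a - b - al) / 2 |
      a - b < - al /\ excess al a b = (a - b + al) / 2].
Proof.
move=> al0; rewrite /excess.
have [h1|h1] := ltP al (a - b).
  by constructor 2; rewrite max_l; [rewrite min_r; [split|]|]; lra.
have [h2|h2] := ltP (a - b) (- al).
  by constructor 3; rewrite max_r; [rewrite min_l; [split|]|]; lra.
by constructor 1; split; [apply/andP; split|rewrite max_l; [rewrite min_l|]]; lra.
Qed.

Lemma excess_trunc2 al a b : 0 < al ->
  Num.max (Num.min b ((a + b + al) / 2)) ((a + b - al) / 2) = b + excess al a b.
Proof.
move=> al0; have [[/andP[? ?] ->]|[? ->]|[? ->]] := excessP a b al0.
- by rewrite min_l; [rewrite max_l|]; lra.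
- by rewrite min_l; [rewrite max_r|]; lra.
- by rewrite min_r; [rewrite max_l|]; lra.
Qed.

(** [excess al a b] is the difference between [(a - b) / 2] and its projection
    onto [[- al / 2, al / 2]], so its modulus is the distance to that interval,
    in which [p / 2] competes. *)
Lemma excess_dist al a b p : 0 < al -> `|p| <= al ->
  `|excess al a b| <= `|2^-1 * (p - (a - b))|.
Proof.
move=> al0; rewrite !ler_norml => /andP[? ?].
have := ler_norm (2^-1 * (p - (a - b))).
have := ler_norm (- (2^-1 * (p - (a - b)))); rewrite normrN => ? ?.
by have [[/andP[? ?] ->]|[? ->]|[? ->]] := excessP a b al0;
  apply/andP; split; lra.
Qed.

(** The projection of [(a - b) / 2] competes in the distance of [(a' - b') / 2]
    to the interval. *)
Lemma excess_le al a b a' b' : 0 < al ->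
  `|excess al a' b'| <= `|excess al a b + 2^-1 * ((a' - b') - (a - b))|.
Proof.
move=> al0; set z := _ + _; have := ler_norm z; have := ler_norm (- z).
rewrite normrN ler_norml /z => {z}.
have [[/andP[? ?] ->]|[? ->]|[? ->]] := excessP a b al0;
have [[/andP[? ?] ->]|[? ->]|[? ->]] := excessP a' b' al0;
by move=> ? ?; apply/andP; split; lra.
Qed.

Lemma excess_Lipschitz al a b a' b' : 0 < al ->
  `|excess al a' b' - excess al a b| <= `|2^-1 * ((a' - b') - (a - b))|.
Proof.
move=> al0; set z := 2^-1 * _; have := ler_norm z; have := ler_norm (- z).
rewrite normrN ler_norml /z => {z}.
have [[/andP[? ?] ->]|[? ->]|[? ->]] := excessP a b al0;
have [[/andP[? ?] ->]|[? ->]|[? ->]] := excessP a' b' al0;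
by move=> ? ?; apply/andP; split; lra.
Qed.

Lemma excess_eq0 al a b : 0 < al -> (excess al a b == 0) = (`|a - b| <= al).
Proof.
move=> al0; rewrite ler_norml.
have [[-> ->]|[h ->]|[h ->]] := excessP a b al0; first by rewrite eqxx.
- by apply/eqP/idP => [?|/andP[? ?]]; [apply/andP; split|]; lra.
- by apply/eqP/idP => [?|/andP[? ?]]; [apply/andP; split|]; lra.
Qed.

Section Ltrunc.
Variables (al : R) (al0 : 0 < al).

Definition Lexcess u v : H := u - Ltrunc1 al0 u v.

Lemma Ltrunc1E u v : Ltrunc1 al0 u v = u - Lexcess u v.
Proof. by rewrite /Lexcess opprB addrC subrK. Qed.

Lemma LexcessE u v : \forall x \ae mu, Lexcess u v x = excess al (u x) (v x).
Proof.
have HE := LclassE (Lfun_Sub (lee1n 2) (trunc1_Lfun u v al0)).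
apply: ae_mono (ae_and (LspaceDE u (- Ltrunc1 al0 u v))
  (ae_and (LspaceNE (Ltrunc1 al0 u v)) HE)) => x [-> [-> /(_ I) ->]].
by [].
Qed.

Lemma Ltrunc2E u v : Ltrunc2 al0 u v = v + Lexcess u v.
Proof.
apply: ae_eq_L2.
have HE := LclassE (Lfun_Sub (lee1n 2) (trunc2_Lfun u v al0)).
apply: ae_mono (ae_and (LspaceDE v (Lexcess u v)) (ae_and (LexcessE u v) HE))
  => x [-> [-> /(_ I) ->]].
exact: excess_trunc2.
Qed.

Lemma Lspace_BE u v : \forall x \ae mu, (u - v) x = u x - v x.
Proof.
by apply: ae_mono (ae_and (LspaceDE u (- v)) (LspaceNE v)) => x [-> ->].
Qed.

Lemma Lexcess_dist u v (p q : H) : (\forall x \ae mu, `|(p - q) x| <= al) ->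
  `|Lexcess u v| <= `|2^-1 *: ((p - q) - (u - v))|.
Proof.
move=> pq; apply: le_L2norm.
apply: ae_mono (ae_and (LexcessE u v) (ae_and pq (ae_and (Lspace_BE u v)
  (ae_and (Lspace_BE (p - q) (u - v)) (LspaceZE 2^-1 (p - q - (u - v))))))).
move=> x [-> [pqx [uvx [pquv ->]]]]; rewrite pquv uvx.
exact: excess_dist.
Qed.

Lemma Lexcess_le u v (u' v' : H) :
  `|Lexcess u' v'| <= `|Lexcess u v + 2^-1 *: ((u' - v') - (u - v))|.
Proof.
apply: le_L2norm.
apply: ae_mono (ae_and (ae_and (LexcessE u v) (LexcessE u' v'))
  (ae_and (ae_and (Lspace_BE u v) (Lspace_BE u' v'))
  (ae_and (ae_and (Lspace_BE (u' - v') (u - v))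
          (LspaceZE 2^-1 (u' - v' - (u - v))))
          (LspaceDE (Lexcess u v) (2^-1 *: ((u' - v') - (u - v))))))).
move=> x [[E1 E2] [[E3 E4] [[E5 E6] E7]]]; rewrite E7 E6 E5 E4 E3 E2 E1.
exact: excess_le.
Qed.

Lemma Lexcess_Lipschitz u v (u' v' : H) :
  `|Lexcess u' v' - Lexcess u v| <= `|2^-1 *: ((u' - v') - (u - v))|.
Proof.
apply: le_L2norm.
apply: ae_mono (ae_and (ae_and (LexcessE u v) (LexcessE u' v'))
  (ae_and (ae_and (Lspace_BE u v) (Lspace_BE u' v'))
  (ae_and (ae_and (Lspace_BE (u' - v') (u - v))
          (LspaceZE 2^-1 (u' - v' - (u - v))))
          (Lspace_BE (Lexcess u' v') (Lexcess u v))))).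
move=> x [[E1 E2] [[E3 E4] [[E5 E6] E7]]]; rewrite E7 E6 E5 E4 E3 E2 E1.
exact: excess_Lipschitz.
Qed.

Lemma Lexcess_eq0 u v :
  Lexcess u v = 0 <-> \forall x \ae mu, `|(u - v) x| <= al.
Proof.
split=> [e0|uv].
  have := ae_and (LexcessE u v) (ae_and (Lspace_BE u v) (@Lspace0E _ _ _ mu 2 (lee1n 2))).
  rewrite e0; apply: ae_mono => x [E1 [-> E0]]; rewrite -(excess_eq0 _ _ al0).
  by rewrite -E1 E0.
apply: ae_eq_L2; apply: ae_mono (ae_and uv (ae_and (LexcessE u v)
  (ae_and (Lspace_BE u v) (@Lspace0E _ _ _ mu 2 (lee1n 2))))).
move=> x [E1 [-> [E3 ->]]]; apply/eqP.
by rewrite excess_eq0// -E3.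
Qed.

Lemma Ltrunc_dist u v :
  \forall x \ae mu, `|(Ltrunc1 al0 u v - Ltrunc2 al0 u v) x| <= al.
Proof.
rewrite Ltrunc1E Ltrunc2E.
apply: ae_mono (ae_and (ae_and (Lspace_BE (u - Lexcess u v) (v + Lexcess u v)) (Lspace_BE u (Lexcess u v)))
  (ae_and (LspaceDE v (Lexcess u v)) (LexcessE u v))) => x [[-> ->] [-> ->]].
rewrite ler_norml; have al1 : 0 < al := al0.
by have [[/andP[? ?] ->]|[? ->]|[? ->]] := excessP (u x) (v x) al0;
  apply/andP; split; lra.
Qed.

End Ltrunc.

(** If [mu] is the zero measure, the norm is zero by convention and every
    property holds almost everywhere. *)
Lemma Loo_normP u (a : R) : 0 <= a ->
  (Loo_norm u <= a%:E)%E <-> \forall x \ae mu, `|u x| <= a.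
Proof.
move=> a0; rewrite /Loo_norm unlock /Lnorm; case: ifPn => mu0.
  split => [/ess_supP|ua]; first exact: ae_mono.
  by apply/ess_supP; apply: ae_mono ua.
rewrite lee_fin a0; split => // _.
exists setT; split => //; apply/eqP; rewrite eq_le measure_ge0 andbT.
by rewrite leNgt.
Qed.

End truncation.

(** * The excess along two gradient curves *)

Section gradient_curves.
Context d (T : measurableType d) (R : realType) (mu : {measure set T -> \bar R}).
Local Notation H := (LspaceType2 mu).
Local Notation leb := (@lebesgue_measure R).
Variable phiH : H -> \bar R.
Hypotheses (phiHNy : gtNy_functional phiH).

(** A solution of the gradient flow of [phiH], up to its initial value. *)
Definition gradient_curve (u g : R -> H) := curve u g /\
  \forall r \ae leb, 0 < r -> supports id phiH (- g r) (u r).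

Lemma within_at0 (u : R -> H) (e : R) : {within `[0, +oo[, continuous u} ->
  0 < e -> exists2 n, 0 < n & forall r, 0 <= r <= n -> `|u r - u 0| <= e.
Proof.
move=> /subspace_continuousP cu e0.
have /cu c0 : [set` `[0, +oo[] (0 : R) by rewrite /= in_itv/= lexx.
have := c0 _ (nbhsx_ballx (u 0) e e0).
rewrite /= => -[n /= n0 H]; exists (n / 2) => [|r /andP[r0 rn]].
  by rewrite divr_gt0.
have : (u @^-1` ball (u 0) e) r.
  apply: H => /=; last by rewrite in_itv/= r0.
  by rewrite sub0r normrN ger0_norm//; lra.
by rewrite /= -ball_normE /= distrC => /ltW.
Qed.

Lemma norm_sum2 (a b a' b' : H) : `|(a - b) - (a' - b')| <= `|a - a'| + `|b - b'|.
Proof.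
have -> : (a - b) - (a' - b') = (a - a') - (b - b').
  by rewrite !opprB addrACA [RHS]addrACA [- b - a']addrC.
exact: ler_normB.
Qed.

Section excess_decay.
Variables (al : R) (al0 : 0 < al).
Hypothesis phiH_trunc : forall x y : H,
  (phiH (Ltrunc1 al0 x y) + phiH (Ltrunc2 al0 x y) <= phiH x + phiH y)%E.

(** Add the subgradient inequality at [x], tested with the first truncation, and
    the one at [y], tested with the second; the values of [phiH] that remain are
    those of the truncation inequality. *)
Lemma supports_excess f1 f2 x y :
  supports id phiH (- f1) x -> supports id phiH (- f2) y ->
  L2dot f1 (Lexcess al0 x y) - L2dot f2 (Lexcess al0 x y) <= 0.
Proof.
move=> s1 s2; have [[xy _] [yy _]] := (s1, s2).
have := phiH_trunc x y; rewrite (gtNy_fineK phiHNy xy) (gtNy_fineK phiHNy yy) => tr.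
have sy : (phiH (Ltrunc1 al0 x y) + phiH (Ltrunc2 al0 x y) < +oo)%E.
  by apply: le_lt_trans tr _; rewrite -EFinD ltry.
have [ty1 ty2] := adde_lty_split (phiHNy _) (phiHNy _) sy.
move: tr; rewrite {1}(gtNy_fineK phiHNy ty1) {1}(gtNy_fineK phiHNy ty2) -!EFinD lee_fin.
have := supports_le phiHNy s1 ty1; have := supports_le phiHNy s2 ty2; rewrite /=.
rewrite [in X in L2dot _ X]Ltrunc2E [in X in L2dot _ X]addrAC subrr add0r.
rewrite [in X in L2dot _ (X - x)]Ltrunc1E addrAC subrr add0r !L2dotE.
set a := fine _; set b := fine _; set c := fine _; set e := fine _.
set p := L2dot _ _; set q := L2dot _ _; lra.
Qed.

(** With [w := u1 - u2] and [E] the excess, [Lexcess_le] gives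
    [`|E t| ^+ 2 <= `|E s + 2^-1 *: (w t - w s)| ^+ 2].  The cross term
    [L2dot (w t - w s) (E s)] is the integral of the derivative of [w] paired
    with [E s]; exchanging [E s] for [E r] costs [2 * M * (M * (t - s))], and
    with [E r] the pairing is nonpositive. *)
Lemma excess_step u1 g1 u2 g2 s t M : gradient_curve u1 g1 ->
  gradient_curve u2 g2 -> 0 < s -> s <= t -> 0 <= M ->
  (\forall r \ae leb, r \in `[s, t] -> `|g1 r| <= M) ->
  (\forall r \ae leb, r \in `[s, t] -> `|g2 r| <= M) ->
  `|Lexcess al0 (u1 t) (u2 t)| ^+ 2 - `|Lexcess al0 (u1 s) (u2 s)| ^+ 2 <=
  3 * M ^+ 2 * (t - s) ^+ 2.
Proof.
move=> [c1 G1] [c2 G2] s0 st M0 gM1 gM2.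
pose E r := Lexcess al0 (u1 r) (u2 r).
have ts0 : 0 <= t - s by rewrite subr_ge0.
have WL r : r \in `[s, t] ->
    `|(u1 r - u2 r) - (u1 s - u2 s)| <= 2 * M * (r - s).
  rewrite in_itv/= => /andP[sr rt]; apply: le_trans (norm_sum2 _ _ _ _) _.
  have sub q : q \in `[s, r] -> q \in `[s, t].
    by rewrite !in_itv/= => /andP[-> /le_trans]; apply.
  have gsub (g : R -> H) : (\forall q \ae leb, q \in `[s, t] -> `|g q| <= M) ->
      \forall q \ae leb, q \in `[s, r] -> `|g q| <= M.
    by apply: ae_mono => q gq /sub; exact: gq.
  have := curve_Lipschitz c1 s0 sr M0 (gsub _ gM1).
  have := curve_Lipschitz c2 s0 sr M0 (gsub _ gM2).
  by lra.
have EL r : r \in `[s, t] -> `|E r - E s| <= M * (t - s).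
  move=> rst; apply: le_trans (Lexcess_Lipschitz al0 _ _ _ _) _.
  rewrite normrZ ger0_norm ?invr_ge0//.
  have := WL r rst; move: rst; rewrite in_itv/= => /andP[sr rt].
  have : M * (r - s) <= M * (t - s) by rewrite ler_wpM2l// lerB.
  by lra.
have tst : t \in `[s, t] by rewrite in_itv/= st lexx.
have dW : L2dot ((u1 t - u2 t) - (u1 s - u2 s)) (E s) <=
    2 * M ^+ 2 * (t - s) * (t - s).
  have -> : (u1 t - u2 t) - (u1 s - u2 s) = (u1 t - u1 s) - (u2 t - u2 s).
    by rewrite !opprB addrACA [RHS]addrACA [- u2 t - u1 s]addrC.
  rewrite L2dotBl -L2dotNr; apply: (curve_pair_le c1 c2 s0 st).
  apply: ae_mono (ae_and (ae_and G1 G2) (ae_and gM1 gM2)).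
  move=> r [[H1 H2] [H3 H4]] rst.
  have r0 : 0 < r by move: rst; rewrite in_itv/= => /andP[+ _]; exact: lt_le_trans s0.
  have := supports_excess (H1 r0) (H2 r0); rewrite -/(E r).
  have -> : L2dot (g1 r) (E s) + L2dot (g2 r) (- E s) =
     (L2dot (g1 r) (E r) - L2dot (g2 r) (E r)) - L2dot (g1 r) (E r - E s)
     + L2dot (g2 r) (E r - E s) by rewrite !L2dotE; ring.
  have := L2dot_norm (g1 r) (E r - E s); have := L2dot_norm (g2 r) (E r - E s).
  have gE (f : H) : `|f| <= M -> `|f| * `|E r - E s| <= M * (M * (t - s)).
    by move=> fM; rewrite ler_pM// EL.
  rewrite !ler_norml.
  have := gE _ (H3 rst); have := gE _ (H4 rst).
  set p := `|g1 r| * _; set q := `|g2 r| * _.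
  move=> ? ? /andP[? ?] /andP[? ?] ?; lra.
have := Lexcess_le al0 (u1 s) (u2 s) (u1 t) (u2 t).
rewrite -ler_sqr ?nnegrE// (sqr_normD (Lexcess al0 (u1 s) (u2 s))).
rewrite L2dotZr normrZ exprMn.
rewrite (ger0_norm (_ : 0 <= 2^-1)) ?invr_ge0//.
have : `|(u1 t - u2 t) - (u1 s - u2 s)| ^+ 2 <= (2 * M * (t - s)) ^+ 2.
  by rewrite ler_sqr ?nnegrE ?mulr_ge0// WL.
rewrite -/(E t) -/(E s) in dW *.
move: dW; rewrite (L2dotC _ (E s)).
set w := `|_ - _| ^+ 2; set x := L2dot _ _; set y := `|E s| ^+ 2; set z := `|E t| ^+ 2.
have -> : (2 * M * (t - s)) ^+ 2 = 4 * (M ^+ 2 * (t - s) ^+ 2) by ring.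
have -> : 2 * M ^+ 2 * (t - s) * (t - s) = 2 * (M ^+ 2 * (t - s) ^+ 2) by ring.
have -> : 3 * M ^+ 2 * (t - s) ^+ 2 = 3 * (M ^+ 2 * (t - s) ^+ 2) by ring.
set m := M ^+ 2 * _.
have -> : (2 : R)^-1 ^+ 2 = 4^-1 by field.
lra.
Qed.

(** The norm of the excess is nonincreasing on every [[a, b]] with [0 < a], and
    its value at [a] tends to that at [0]. *)
Lemma excess_zero u1 g1 u2 g2 b : gradient_curve u1 g1 ->
  gradient_curve u2 g2 -> 0 <= b -> Lexcess al0 (u1 0) (u2 0) = 0 ->
  Lexcess al0 (u1 b) (u2 b) = 0.
Proof.
move=> G1 G2; rewrite le_eqVlt => /predU1P[<-//|b0] E0.
pose E r := Lexcess al0 (u1 r) (u2 r).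
have [[[cu1 _ _] _] [[cu2 _ _] _]] := (G1, G2).
have mono a : 0 < a -> a <= b -> `|E b| <= `|E a|.
  move=> a0 ab; rewrite -ler_sqr ?nnegrE//.
  have [M1 M10 gM1] := curve_bound b G1.1 a0.
  have [M2 M20 gM2] := curve_bound b G2.1 a0.
  apply: (@quadratic_nonincreasing _ (fun r => `|E r| ^+ 2) a b (3 * (M1 + M2) ^+ 2)) => //.
  move=> s t as_ st tb; apply: (excess_step G1 G2) => //.
  - exact: lt_le_trans as_.
  - exact: addr_ge0.
  - apply: ae_mono gM1 => r H rst; apply: le_trans (H _) _; last by rewrite lerDl.
    by move: rst; rewrite !in_itv/= => /andP[? ?]; apply/andP; split; lra.
  - apply: ae_mono gM2 => r H rst; apply: le_trans (H _) _; last by rewrite lerDr.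
    by move: rst; rewrite !in_itv/= => /andP[? ?]; apply/andP; split; lra.
apply/eqP; rewrite -normr_eq0 eq_le normr_ge0 andbT.
apply/ler_addgt0Pl => e e0; rewrite addr0.
have [n1 n10 H1] := within_at0 cu1 e0; have [n2 n20 H2] := within_at0 cu2 e0.
pose a := Num.min b (Num.min n1 n2).
have a0 : 0 < a by rewrite !lt_min b0 n10.
have ab : a <= b by rewrite ge_min lexx.
apply: le_trans (mono a a0 ab) _.
have -> : E a = E a - Lexcess al0 (u1 0) (u2 0) by rewrite E0 subr0.
apply: le_trans (Lexcess_Lipschitz al0 _ _ _ _) _.
rewrite normrZ ger0_norm ?invr_ge0//.
have := norm_sum2 (u1 a) (u2 a) (u1 0) (u2 0).
have : `|u1 a - u1 0| <= e by apply: H1; rewrite ltW//= !ge_min lexx !orbT.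
have : `|u2 a - u2 0| <= e by apply: H2; rewrite ltW//= !ge_min lexx !orbT.
by lra.
Qed.

End excess_decay.

End gradient_curves.

(** * Gradient curves that do not approach a point *)

Section distance.
Context d (T : measurableType d) (R : realType) (mu : {measure set T -> \bar R}).
Local Notation H := (LspaceType2 mu).
Local Notation leb := (@lebesgue_measure R).
Variable phiH : H -> \bar R.
Hypotheses (phiHNy : gtNy_functional phiH) (phiH_lsc : lsc_functional phiH).

Lemma lsc_at0 (u : R -> H) (a : R) : {within `[0, +oo[, continuous u} ->
  (a%:E < phiH (u 0%R))%E ->
  exists2 n, 0 < n & forall r, 0 <= r <= n -> (a%:E < phiH (u r))%E.
Proof.
move=> cu au.
have : nbhs (u 0) (~` [set y | (phiH y <= a%:E)%E]).
  apply: open_nbhs_nbhs; split; first exact/closed_openC/phiH_lsc.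
  by apply/negP; rewrite -ltNge.
rewrite -nbhs_ballE => -[e /= e0 eB].
have e20 : 0 < e / 2 by rewrite divr_gt0.
have [n n0 H] := within_at0 cu e20; exists n => // r rn.
rewrite ltNge; apply/negP; apply: (eB (u r)).
by rewrite -ball_normE/= distrC; apply: le_lt_trans (H r rn) _; lra.
Qed.

Lemma lt_adde_split (p q : \bar R) (m : R) : (-oo < p)%E -> (-oo < q)%E ->
  (m%:E < p + q)%E ->
  exists a b : R, [/\ (a%:E < p)%E, (b%:E < q)%E & m < a + b].
Proof.
case: p q => [p||] [q||]// _ _; rewrite ?lte_fin => mpq.
- exists (p - (p + q - m) / 3), (q - (p + q - m) / 3); rewrite !lte_fin.
  by split; lra.
- by exists (p - 1), (m - p + 2); rewrite lte_fin ltry; split => //; lra.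
- by exists (m - q + 2), (q - 1); rewrite lte_fin ltry; split => //; lra.
- by exists m, 1; rewrite !ltry; split => //; lra.
Qed.

(** Expand the squares around time [s].  The linear part is the integral of
    [<u', u s - x>]; exchanging [u s] for [u r] costs [M ^+ 2 * (t - s)] per
    curve, and then the subgradient inequality bounds the pairing by
    [phiH x - phiH (u r)]. *)
Lemma distance_step u1 g1 u2 g2 x1 x2 s t M dl :
  gradient_curve phiH u1 g1 -> gradient_curve phiH u2 g2 ->
  (phiH x1 < +oo)%E -> (phiH x2 < +oo)%E -> 0 < s -> s <= t -> 0 <= M ->
  (forall r, r \in `[s, t] -> (phiH (u1 r) < +oo)%E -> (phiH (u2 r) < +oo)%E ->
    fine (phiH x1) + fine (phiH x2) - fine (phiH (u1 r)) - fine (phiH (u2 r))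
    <= - dl) ->
  (\forall r \ae leb, r \in `[s, t] -> `|g1 r| <= M) ->
  (\forall r \ae leb, r \in `[s, t] -> `|g2 r| <= M) ->
  (`|u1 t - x1| ^+ 2 + `|u2 t - x2| ^+ 2) -
  (`|u1 s - x1| ^+ 2 + `|u2 s - x2| ^+ 2) <=
  - 2 * dl * (t - s) + 6 * M ^+ 2 * (t - s) ^+ 2.
Proof.
move=> [c1 G1] [c2 G2] x1y x2y s0 st M0 le_dl gM1 gM2.
have ts0 : 0 <= t - s by rewrite subr_ge0.
have L (u g : R -> H) : curve u g ->
    (\forall r \ae leb, r \in `[s, t] -> `|g r| <= M) ->
    forall r, r \in `[s, t] -> `|u r - u s| <= M * (t - s).
  move=> c gM r; rewrite in_itv/= => /andP[sr rt].
  apply: le_trans (curve_Lipschitz c s0 sr M0 _) _; last by rewrite ler_wpM2l// lerB.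
  apply: ae_mono gM => q H Hq; apply: H; move: Hq.
  by rewrite !in_itv/= => /andP[-> /le_trans]; apply.
have L1 := L _ _ c1 gM1; have L2 := L _ _ c2 gM2.
have K : L2dot (u1 t - u1 s) (u1 s - x1) + L2dot (u2 t - u2 s) (u2 s - x2) <=
    (- dl + 2 * M ^+ 2 * (t - s)) * (t - s).
  apply: (curve_pair_le c1 c2 s0 st).
  apply: ae_mono (ae_and (ae_and G1 G2) (ae_and gM1 gM2)).
  move=> r [[H1 H2] [H3 H4]] rst.
  have r0 : 0 < r by move: rst; rewrite in_itv/= => /andP[+ _]; exact: lt_le_trans s0.
  have S1 := H1 r0; have S2 := H2 r0.
  have := le_dl r rst S1.1 S2.1.
  have := supports_le phiHNy S1 x1y; have := supports_le phiHNy S2 x2y; rewrite /=.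
  have P (g v w x : H) : `|g| <= M -> `|v - w| <= M * (t - s) ->
      L2dot g (w - x) <= L2dot (- g) (x - v) + M * (M * (t - s)).
    move=> gM vw; have -> : L2dot g (w - x) = L2dot (- g) (x - v) - L2dot g (v - w).
      by rewrite !L2dotE; ring.
    rewrite lerD2l; have := L2dot_norm g (v - w); rewrite ler_norml => /andP[+ _].
    rewrite lerNl => /le_trans; apply; exact: ler_pM.
  have := P _ _ _ x1 (H3 rst) (L1 r rst); have := P _ _ _ x2 (H4 rst) (L2 r rst).
  rewrite mulrA -expr2.
  set a := fine _; set b := fine _; set c := fine _; set e := fine _.
  set m := M ^+ 2; lra.
have ex (u : R -> H) x : `|u t - x| ^+ 2 = `|u s - x| ^+ 2 +
    2 * L2dot (u t - u s) (u s - x) + `|u t - u s| ^+ 2.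
  rewrite (L2dotC _ (u s - x)) -sqr_normD; congr (`|_| ^+ 2).
  by rewrite [RHS]addrC addrA subrK.
have tst : t \in `[s, t] by rewrite in_itv/= st lexx.
have sq (u : R -> H) : `|u t - u s| <= M * (t - s) ->
    `|u t - u s| ^+ 2 <= M ^+ 2 * (t - s) ^+ 2.
  by move=> ?; rewrite -exprMn ler_sqr ?nnegrE// mulr_ge0.
have := sq _ (L1 t tst); have := sq _ (L2 t tst); move: K; rewrite (ex u1 x1) (ex u2 x2).
have -> : (- dl + 2 * M ^+ 2 * (t - s)) * (t - s) =
  - (dl * (t - s)) + 2 * (M ^+ 2 * (t - s) ^+ 2) by ring.
rewrite -[6 * _ * _]mulrA; set m := M ^+ 2 * _.
have -> : - 2 * dl * (t - s) = - 2 * (dl * (t - s)) by ring.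
set n := dl * _.
set a := L2dot _ _; set b := L2dot _ _; lra.
Qed.

(** If the conclusion failed, lower semicontinuity would keep
    [phiH (u1 r) + phiH (u2 r)] above [phiH x1 + phiH x2] by some [dl > 0] for
    [r] up to some [b], and [G], the sum of the squared distances to [x1] and
    [x2], would satisfy [G b + 2 * dl * (b - a) <= G a].  Letting [a] tend to [0]
    contradicts [G 0 <= G b]. *)
Lemma closest_point_le u1 g1 u2 g2 x1 x2 :
  gradient_curve phiH u1 g1 -> gradient_curve phiH u2 g2 ->
  (forall t, 0 <= t -> `|u1 0 - x1| ^+ 2 + `|u2 0 - x2| ^+ 2 <=
                       `|u1 t - x1| ^+ 2 + `|u2 t - x2| ^+ 2) ->
  (phiH (u1 0%R) + phiH (u2 0%R) <= phiH x1 + phiH x2)%E.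
Proof.
move=> G1 G2 closest.
have [x1y|] := ltP (phiH x1) +oo%E; last first.
  by rewrite leye_eq => /eqP ->; rewrite addye ?leey// gt_eqF.
have [x2y|] := ltP (phiH x2) +oo%E; last first.
  by rewrite leye_eq => /eqP ->; rewrite addey ?leey// gt_eqF.
rewrite (gtNy_fineK phiHNy x1y) (gtNy_fineK phiHNy x2y) -EFinD leNgt.
apply/negP => /(lt_adde_split (phiHNy _) (phiHNy _))[a1 [a2 [a1u a2u mlt]]].
set m := _ + _ in mlt; pose dl := a1 + a2 - m.
have dl0 : 0 < dl by rewrite subr_gt0.
have [[[cu1 _ _] _] [[cu2 _ _] _]] := (G1, G2).
have [n1 n10 H1] := lsc_at0 cu1 a1u; have [n2 n20 H2] := lsc_at0 cu2 a2u.
pose b := Num.min n1 n2.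
have b0 : 0 < b by rewrite lt_min n10.
pose G r := `|u1 r - x1| ^+ 2 + `|u2 r - x2| ^+ 2.
have decay a : 0 < a -> a <= b -> G b + 2 * dl * (b - a) <= G a.
  move=> a0 ab.
  have [M1 M10 gM1] := curve_bound b G1.1 a0.
  have [M2 M20 gM2] := curve_bound b G2.1 a0.
  have := @quadratic_nonincreasing _ (fun r => G r + 2 * dl * (r - a)) a b
    (6 * (M1 + M2) ^+ 2) ab.
  rewrite subrr mulr0 addr0; apply => s t as_ st tb.
  have : G t - G s <= - 2 * dl * (t - s) + 6 * (M1 + M2) ^+ 2 * (t - s) ^+ 2.
    apply: (distance_step G1 G2) => //.
    - exact: lt_le_trans as_.
    - exact: addr_ge0.
    - move=> r; rewrite in_itv/= => /andP[sr rt] y1 y2.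
      have rb : 0 <= r <= b by apply/andP; split; lra.
      have /andP[r0 rbb] := rb; move: rbb; rewrite le_min => /andP[rn1 rn2].
      have := H1 r; rewrite r0 rn1 => /(_ isT).
      have := H2 r; rewrite r0 rn2 => /(_ isT).
      rewrite {1}(gtNy_fineK phiHNy y1) {1}(gtNy_fineK phiHNy y2) !lte_fin /dl /m.
      set p := fine _; set q := fine _; lra.
    - apply: ae_mono gM1 => r H rst; apply: le_trans (H _) _; last by rewrite lerDl.
      by move: rst; rewrite !in_itv/= => /andP[? ?]; apply/andP; split; lra.
    - apply: ae_mono gM2 => r H rst; apply: le_trans (H _) _; last by rewrite lerDr.
      by move: rst; rewrite !in_itv/= => /andP[? ?]; apply/andP; split; lra.
  by lra.
(* [e] is such that moving each curve by at most [e] increases the sum of the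
   squared distances by less than [dl * b]. *)
pose N1 := `|u1 0 - x1|; pose N2 := `|u2 0 - x2|.
have N10 : 0 <= N1 by exact: normr_ge0.
have N20 : 0 <= N2 by exact: normr_ge0.
have N0 : 0 < 2 * (N1 + N2 + 1) + 1 by lra.
pose e := Num.min 1 (dl * b / (2 * (N1 + N2 + 1) + 1)).
have e0 : 0 < e by rewrite lt_min ltr01 divr_gt0// mulr_gt0.
have e1 : e <= 1 by rewrite ge_min lexx.
have eN : e * (2 * (N1 + N2 + 1) + 1) <= dl * b.
  by rewrite -ler_pdivlMr// ge_min lexx orbT.
have [k1 k10 K1] := within_at0 cu1 e0; have [k2 k20 K2] := within_at0 cu2 e0.
pose a := Num.min (b / 2) (Num.min k1 k2).
have a0 : 0 < a by rewrite !lt_min k10 k20 divr_gt0.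
have ab2 : a <= b / 2 by rewrite ge_min lexx.
have ab : a <= b by lra.
have sq (u : R -> H) x : `|u a - u 0| <= e ->
    `|u a - x| ^+ 2 <= (`|u 0 - x| + e) ^+ 2.
  move=> ue; rewrite ler_sqr ?nnegrE ?addr_ge0 ?(ltW e0)//.
  have -> : u a - x = (u 0 - x) + (u a - u 0) by rewrite [RHS]addrC addrA subrK.
  by apply: le_trans (ler_normD _ _) _; rewrite lerD2l.
have S1 : `|u1 a - x1| ^+ 2 <= (N1 + e) ^+ 2.
  by apply/sq/K1; rewrite ltW//= !ge_min lexx !orbT.
have S2 : `|u2 a - x2| ^+ 2 <= (N2 + e) ^+ 2.
  by apply/sq/K2; rewrite ltW//= !ge_min lexx !orbT.
have := decay a a0 ab; have := closest b (ltW b0).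
rewrite /G -/N1 -/N2.
have dlb : dl * b <= 2 * dl * (b - a).
  rewrite [2 * dl]mulrC -mulrA ler_pM2l//; lra.
have ee : e ^+ 2 <= e by rewrite expr2 ger_pMl.
move: S1 S2; rewrite !sqrrD.
have : 0 < e + 2 * (e - e ^+ 2) by lra.
move: eN dlb; set q := dl * b; set z := 2 * dl * _.
set v1 := `|_| ^+ 2; set v2 := `|u2 a - x2| ^+ 2.
set v3 := `|u1 b - x1| ^+ 2; set v4 := `|u2 b - x2| ^+ 2.
rewrite -[N1 * e *+ 2]mulr_natl -[N2 * e *+ 2]mulr_natl; lra.
Qed.

End distance.

(** * The semigroup *)

Section semigroup.
Context d (T : measurableType d) (R : realType) (mu : {measure set T -> \bar R}).
Local Notation H := (LspaceType2 mu).
Context (V : tvsType R) (j : {linear V -> H}) (phi : V -> \bar R)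
  (phiH : H -> \bar R) (S : R -> H -> H).
Hypotheses (phiNy : gtNy_functional phi) (phi_dense : dense (j @` effective_domain phi))
  (phiH_P : is_phiH j phi phiH) (S_P : generated_semigroup j phi S).

(** A subgradient with respect to [j] and [phi] is one of [phiH], so trajectories
    are gradient curves of [phiH]. *)
Lemma semigroup_curve (u0 : H) :
  S 0 u0 = u0 /\ exists g, gradient_curve phiH (S ^~ u0) g.
Proof.
have [phiHNy cvx _ _ sub] := phiH_P.
have cl : closure (j @` effective_domain phi) u0.
  move=> B; rewrite nbhsE => -[W [Wo Wu0] WB].
  have [y [Wy jy]] := phi_dense (ex_intro _ u0 Wu0) Wo.
  by exists y; split => //; exact: WB.
have [cu S0 [g [_ Lg wd sg]]] := S_P cl; split => //; exists g; split => //.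
apply: ae_mono sg => r H1 /H1 /sub /(subgradient_supports phiHNy cvx).
by move=> [_ -> ?].
Qed.

Definition trunc_inequality := forall (u1 u2 : H) (al : R) (al0 : 0 < al),
  (phiH (Ltrunc1 al0 u1 u2) + phiH (Ltrunc2 al0 u1 u2) <= phiH u1 + phiH u2)%E.

Lemma contractive_trunc : Loo_contractive S -> trunc_inequality.
Proof.
move=> contr x1 x2 al al0; have [phiHNy _ _ lsc _] := phiH_P.
set y1 := Ltrunc1 al0 x1 x2; set y2 := Ltrunc2 al0 x1 x2.
have [S1 [g1 G1]] := semigroup_curve y1; have [S2 [g2 G2]] := semigroup_curve y2.
rewrite -[y1]S1 -[y2]S2; apply: (closest_point_le phiHNy lsc G1 G2) => t t0.
rewrite S1 S2; set p := S t y1; set q := S t y2.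
have pq : \forall x \ae mu, `|(p - q) x| <= al.
  apply/Loo_normP; first exact: ltW.
  apply: le_trans (contr y1 y2 t t0) _; apply/Loo_normP; first exact: ltW.
  exact: Ltrunc_dist.
(* The parallelogram inequality turns the distance of the differences into the
   distance of the pairs: among the pairs whose difference is bounded by [al],
   the pair of truncations is closest to [(x1, x2)]. *)
have := Lexcess_dist al0 x1 x2 pq.
rewrite /y1 /y2 Ltrunc1E Ltrunc2E; set e := Lexcess _ _ _.
have -> : x1 - e - x1 = - e by rewrite addrAC subrr add0r.
have -> : x2 + e - x2 = e by rewrite addrAC subrr add0r.
have -> : p - q - (x1 - x2) = (p - x1) - (q - x2).
  by rewrite !opprB addrACA [RHS]addrACA [- q - x1]addrC.
rewrite normrN -ler_sqr ?nnegrE// normrZ exprMn (sqr_normB (p - x1)).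
have := sqr_ge0 `|p - x1 + (q - x2)|; rewrite (sqr_normD (p - x1)).
rewrite (ger0_norm (_ : 0 <= 2^-1)) ?invr_ge0//.
have -> : (2 : R)^-1 ^+ 2 = 4^-1 by field.
set a := `|p - x1| ^+ 2; set b := `|q - x2| ^+ 2; set c := L2dot _ _.
set f := `|e| ^+ 2; lra.
Qed.

Lemma trunc_contractive : trunc_inequality -> Loo_contractive S.
Proof.
move=> tr u1 u2 t t0; have [phiHNy _ _ _ _] := phiH_P.
have [S1 [g1 G1]] := semigroup_curve u1; have [S2 [g2 G2]] := semigroup_curve u2.
have le_al al : 0 < al -> (Loo_norm (u1 - u2)%R <= al%:E)%E ->
    (Loo_norm (S t u1 - S t u2)%R <= al%:E)%E.
  move=> al0 /(Loo_normP _ (ltW al0)) u12; apply/(Loo_normP _ (ltW al0)).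
  apply/(Lexcess_eq0 al0).
  apply: (excess_zero phiHNy (fun x y => tr x y al al0) G1 G2 t0).
  by rewrite S1 S2; apply/(Lexcess_eq0 al0).
move: le_al; have : (0 <= Loo_norm (u1 - u2)%R)%E by exact: Lnorm_ge0.
case: (Loo_norm (u1 - u2)%R) => [n n0 le_al|_ _|//]; last by rewrite leey.
apply/lee_addgt0Pr => e e0; rewrite -EFinD; apply: le_al.
  by rewrite ltr_wpDl.
by rewrite lee_fin lerDl ltW.
Qed.

End semigroup.

Theorem theorem3p9 (R : realType) (d : measure_display) (Sigma : measurableType d)
    (mu : {measure set Sigma -> \bar R})
    (V : tvsType R) (j : {linear V -> LspaceType2 mu}) (phi : V -> \bar R)
    (phiH : LspaceType2 mu -> \bar R)
    (S : R -> LspaceType2 mu -> LspaceType2 mu) :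
  weakly_continuous j ->
  gtNy_functional phi ->
  convex_functional phi ->
  proper_functional phi ->
  lsc_functional phi ->
  elliptic j phi ->
  dense (j @` effective_domain phi) ->
  is_phiH j phi phiH ->
  generated_semigroup j phi S ->
  [<-> Loo_contractive S;
       forall (u1 u2 : LspaceType2 mu) (alpha : R) (alpha0 : 0 < alpha),
         (phiH (Ltrunc1 alpha0 u1 u2) + phiH (Ltrunc2 alpha0 u1 u2)
          <= phiH u1 + phiH u2)%E;
       forall uh1 uh2 : V,
         effective_domain phi uh1 -> effective_domain phi uh2 ->
         forall (alpha : R) (alpha0 : 0 < alpha),
         exists vh1 vh2 : V,
           [/\ effective_domain phi vh1, effective_domain phi vh2,
               Ltrunc1 alpha0 (j uh1) (j uh2) = j vh1,
               Ltrunc2 alpha0 (j uh1) (j uh2) = j vh2 &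
               (phi vh1 + phi vh2 <= phi uh1 + phi uh2)%E]].
Proof.
move=> jweak phiNy phi_convex prop phi_lsc ell phi_dense phiH_P S_P.
have [phiHNy _ _ _ _] := phiH_P.
have [c [cle cge]] := phiH_image jweak phiNy phi_convex prop phi_lsc ell phiH_P.
have fin v (h : \bar R) : (h < +oo)%E -> (phi v + c%:E <= h)%E -> (phi v < +oo)%E.
  move=> hy le; exact: (adde_lty_split (phiNy v) (ltNyr c) (le_lt_trans le hy)).1.
tfae.
- exact: (contractive_trunc phi_dense phiH_P S_P).
- move=> tr u1 u2 u1y u2y al al0.
  have := tr (j u1) (j u2) al al0.
  move: (cle u1) (cle u2).
  rewrite (gtNy_fineK phiNy u1y) (gtNy_fineK phiNy u2y) -!EFinD => le1 le2 le12.
  have le := le_trans le12 (leeD le1 le2); rewrite -EFinD in le.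
  have leNy := le_lt_trans le (ltry _).
  have [y1 y2] := adde_lty_split (phiHNy _) (phiHNy _) leNy.
  have [v1 jv1 le_v1] := cge _ y1; have [v2 jv2 le_v2] := cge _ y2.
  have v1y := fin _ _ y1 le_v1; have v2y := fin _ _ y2 le_v2.
  exists v1, v2; split => //.
  have := le_trans (leeD le_v1 le_v2) le.
  rewrite (gtNy_fineK phiNy v1y) (gtNy_fineK phiNy v2y) -!EFinD !lee_fin.
  by lra.
- move=> H3; apply: (trunc_contractive phi_dense phiH_P S_P) => x1 x2 al al0.
  have [x1y|] := ltP (phiH x1) +oo%E; last first.
    by rewrite leye_eq => /eqP ->; rewrite addye ?leey// gt_eqF.
  have [x2y|] := ltP (phiH x2) +oo%E; last first.
    by rewrite leye_eq => /eqP ->; rewrite addey ?leey// gt_eqF.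
  have [w1 jw1 le1] := cge _ x1y; have [w2 jw2 le2] := cge _ x2y.
  have w1y := fin _ _ x1y le1; have w2y := fin _ _ x2y le2.
  have [v1 [v2 [v1y v2y E1 E2 le]]] := H3 _ _ w1y w2y al al0.
  rewrite -jw1 -jw2 E1 E2 jw1 jw2.
  apply: le_trans (leeD (cle v1) (cle v2)) _; apply: le_trans _ (leeD le1 le2).
  move: le; rewrite (gtNy_fineK phiNy v1y) (gtNy_fineK phiNy v2y)
    (gtNy_fineK phiNy w1y) (gtNy_fineK phiNy w2y) -!EFinD !lee_fin; lra.
Qed.
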